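(* Let $M$ be a real constant and let $g=g_1+\overline{g_2}$ be a complex-valued harmonic function in the unit disk $U$, where $g_1,g_2$ are analytic in $U$ and $g_2(0)=0$, with $g(0)=J_g(0)-1=0$ and $|g_1(z)|+|g_2(z)|\le M$ for all $z\in U$. Put $$r_4'=\frac{\lambda_0(M)}{\lambda_0(M)+2\Bigl(M-\frac{\lambda_0^2(M)}{M}\Bigr)+\sqrt{\lambda_0(M)\Bigl(M-\frac{\lambda_0^2(M)}{M}\Bigr)+4\Bigl(M-\frac{\lambda_0^2(M)}{M}\Bigr)^2}},$$ and $$\sigma_4'=\begin{cases}\lambda_0(M)\,r_4'^3-\Bigl(M-\dfrac{\lambda_0^2(M)}{M}\Bigr)\cdot\dfrac{r_4'^4}{1-r_4'}, & M>1,\\ 1, & M=1.\end{cases}$$ Then $F(z)=|z|^2g(z)$ is univalent in the disk $U_{r_4'}$, and $F(U_{r_4'})$ contains the schlicht disk $U_{\sigma_4'}$. The result is sharp for $M=1$, i.e. for $M=1$ the radii $r_4'=\sigma_4'=1$ are best possible (neither can be replaced by a larger constant valid for all such $g$).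
   Context: $U=\{z\in\mathbb{C}:|z|<1\}$ is the open unit disk and, for $r>0$, $U_r=\{z\in\mathbb{C}:|z|<r\}$. Univalent means injective. For a differentiable complex-valued function $f$, with $z=x+iy$, put $f_z=\frac12(f_x-if_y)$, $f_{\overline z}=\frac12(f_x+if_y)$; the Jacobian is $J_f(z)=|f_z(z)|^2-|f_{\overline z}(z)|^2$. With $M_0=\frac{\pi}{2\sqrt[4]{2\pi^2-16}}\approx1.1296$, put $$\lambda_0(M)=\begin{cases}\dfrac{\sqrt2}{\sqrt{M^2-1}+\sqrt{M^2+1}}, & 1\le M\le M_0,\\[2mm] \dfrac{\pi}{4M}, & M>M_0.\end{cases}$$ (The hypotheses force $M\ge1$.) *)

(* Defs.v *)
From Stdlib Require Import Reals.
From Coquelicot Require Import Coquelicot.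
Open Scope R_scope.

(* U_r; the unit disk U is [disk 1]. *)
Definition disk (r : R) (z : C) : Prop := Cmod z < r.

(* Functions with domain D are represented by total functions C -> C whose
   values outside D are irrelevant.  [ex_derive] over C_AbsRing is complex
   differentiability. *)
Definition analytic_on (D : C -> Prop) (f : C -> C) : Prop :=
  forall z : C, D z -> @ex_derive C_AbsRing C_NormedModule f z.

(* u is of class C^2 (at every point of D) and has zero Laplacian there. *)
Definition real_harmonic_on (D : C -> Prop) (u : R -> R -> R) : Prop :=
  forall x y : R, D (x, y) ->
    ex_diff_n u 2 x y /\
    partial_derive 2 0 u x y + partial_derive 0 2 u x y = 0.

Definition harmonic_on (D : C -> Prop) (f : C -> C) : Prop :=
  real_harmonic_on D (fun x y => Re (f (x, y))) /\
  real_harmonic_on D (fun x y => Im (f (x, y))).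

(* Meaningful where the real partial derivatives of f exist. *)
Definition d_x (f : C -> C) (z : C) : C :=
  (Derive (fun t => Re (f (t, Im z))) (Re z),
   Derive (fun t => Im (f (t, Im z))) (Re z)).

Definition d_y (f : C -> C) (z : C) : C :=
  (Derive (fun t => Re (f (Re z, t))) (Im z),
   Derive (fun t => Im (f (Re z, t))) (Im z)).

Definition d_z (f : C -> C) (z : C) : C :=
  (RtoC (1 / 2) * (d_x f z - Ci * d_y f z))%C.

Definition d_zbar (f : C -> C) (z : C) : C :=
  (RtoC (1 / 2) * (d_x f z + Ci * d_y f z))%C.

Definition jacobian (f : C -> C) (z : C) : R :=
  Cmod (d_z f z) ^ 2 - Cmod (d_zbar f z) ^ 2.

(* The function f with domain D is defined and injective on A.  The
   inclusion of A in D matters: no function on U is univalent on a disk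
   larger than U. *)
Definition univalent_on (D : C -> Prop) (f : C -> C) (A : C -> Prop) : Prop :=
  (forall z : C, A z -> D z) /\
  (forall z w : C, A z -> A w -> f z = f w -> z = w).

Definition image_contains (f : C -> C) (A B : C -> Prop) : Prop :=
  forall w : C, B w -> exists z : C, A z /\ f z = w.

(* The fourth root is written as an iterated square root. *)
Definition M0 : R := PI / (2 * sqrt (sqrt (2 * PI ^ 2 - 16))).

Definition lambda0 (M : R) : R :=
  if Rle_dec M M0 then sqrt 2 / (sqrt (M ^ 2 - 1) + sqrt (M ^ 2 + 1))
  else PI / (4 * M).

Definition r4' (M : R) : R :=
  let l := lambda0 M in
  let K := M - l ^ 2 / M in
  l / (l + 2 * K + sqrt (l * K + 4 * K ^ 2)).

(* Only used for M >= 1; the else branch stands for the case M = 1. *)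
Definition sigma4' (M : R) : R :=
  if Rlt_dec 1 M then
    lambda0 M * r4' M ^ 3
    - (M - lambda0 M ^ 2 / M) * (r4' M ^ 4 / (1 - r4' M))
  else 1.

Definition admissible (M : R) (g g1 g2 : C -> C) : Prop :=
  harmonic_on (disk 1) g /\
  analytic_on (disk 1) g1 /\
  analytic_on (disk 1) g2 /\
  (forall z : C, disk 1 z -> g z = (g1 z + Cconj (g2 z))%C) /\
  g2 (RtoC 0) = RtoC 0 /\
  g (RtoC 0) = RtoC 0 /\
  jacobian g (RtoC 0) - 1 = 0 /\
  (forall z : C, disk 1 z -> Cmod (g1 z) + Cmod (g2 z) <= M).

Definition sq_mod_mul (g : C -> C) (z : C) : C :=
  (RtoC (Cmod z ^ 2) * g z)%C.

(* Main.v *)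
Require Import Defs.
From Stdlib Require Import Reals Lra Lia Psatz.
From Coquelicot Require Import Coquelicot.
Open Scope R_scope.

(** Write a = g1'(0), b = g2'(0), l = lambda0 M and K = M - l^2 / M.

    Coefficients.  For every unimodular u the analytic function h = g1 + u g2
    is bounded by M and vanishes at 0.  Such an h has |h'(0)| <= M and Taylor
    coefficients |c_n| <= M - |c_1|^2 / M for n >= 2 ([circle_coef_bound]).
    Choosing u so that |x + u y| = |x| + |y| for the quantities x and y at
    hand ([align_pair]) turns bounds on h into bounds on |g1| + |g2|.  First,
    |a| + |b| <= M; since (|a| + |b|) (|a| - |b|) = J_g(0) = 1, this gives
    |a| - |b| >= 1/M, and 1/M >= l ([lambda0_bounds]).  Second, the n-th
    coefficients of g1 and g2 have moduli with sum at most K for n >= 2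
    ([pair_bound]).

    Geometry.  Put zeta = |z|^2 z.  Then F(z) = a zeta + conj(b zeta) + e,
    where the real-linear part expands distances at least by l and
    e = |z|^2 (sum over n >= 2 of a_n z^n + conj(b_n z^n)).  As a function of
    zeta, |z|^2 z^n is Lipschitz with constant n r^(n-1) on |z| <= r
    ([power_lipschitz]), so e is Lipschitz with constant K (1/(1-r)^2 - 1).
    The radius r4' is the smaller root of l (1-r)^2 = K (4r - 3r^2), and
    4r - 3r^2 dominates 2r - r^2 = 1 - (1-r)^2; so this constant is below l for
    r <= r4', r < 1 ([slope_lt]).  Hence F is injective.  To solve F(z) = w,
    extend e to the whole zeta-plane by composing with the nearest-point
    projection onto |zeta| <= r^3 and apply the contraction principle; the
    estimate |e| <= K r^4/(1-r) confines the solution to |zeta| < r^3 as soon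
    as |w| < l r^3 - K r^4/(1-r) ([perturbation_covers]).

    Complex analysis.  Harmonicity makes g of class C^2, so g1' = g_z and
    conj(g2') = g_zbar are continuous, and Cauchy's formula follows by
    differentiating a mean over a shrinking circle under the integral sign
    ([cauchy_homotopy]).  Power series appear only through the partial
    expansions of the Cauchy kernel ([cauchy_tail_S]).

    Sharpness for M = 1 is witnessed by g(z) = z, for which F(z) = |z|^2 z. *)


(** * Means over the unit circle *)

Lemma continuous_Cpair {U : UniformSpace} (f g : U -> R) (x : U) :
  continuous f x -> continuous g x -> continuous (fun u => (f u, g u) : C) x.
Proof.
  intros Hf Hg.
  apply (continuous_comp_2 f g (fun a b => (a, b) : C) x Hf Hg).
  apply continuous_ext with (f := fun p : R * R => p).
  - now intros [a b].
  - apply continuous_id.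
Qed.

Lemma continuous_Re {U : UniformSpace} (f : U -> C) (x : U) :
  continuous f x -> continuous (fun u => Re (f u)) x.
Proof.
  intros Hf. apply (continuous_comp f (fun p : R * R => fst p)).
  - exact Hf.
  - destruct (f x) as [a b]. apply continuous_fst.
Qed.

Lemma continuous_Im {U : UniformSpace} (f : U -> C) (x : U) :
  continuous f x -> continuous (fun u => Im (f u)) x.
Proof.
  intros Hf. apply (continuous_comp f (fun p : R * R => snd p)).
  - exact Hf.
  - destruct (f x) as [a b]. apply continuous_snd.
Qed.

Lemma continuous_Cplus {U : UniformSpace} (f g : U -> C) (x : U) :
  continuous f x -> continuous g x -> continuous (fun u => (f u + g u)%C) x.
Proof.
  intros Hf Hg. apply continuous_Cpair.
  - apply (continuous_plus (fun u => Re (f u)) (fun u => Re (g u)));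
      now apply continuous_Re.
  - apply (continuous_plus (fun u => Im (f u)) (fun u => Im (g u)));
      now apply continuous_Im.
Qed.

Lemma continuous_Cmult {U : UniformSpace} (f g : U -> C) (x : U) :
  continuous f x -> continuous g x -> continuous (fun u => (f u * g u)%C) x.
Proof.
  intros Hf Hg. apply continuous_Cpair.
  - apply (continuous_minus (fun u => Re (f u) * Re (g u))
                            (fun u => Im (f u) * Im (g u)));
      apply (continuous_mult (K := R_AbsRing));
      auto using continuous_Re, continuous_Im.
  - apply (continuous_plus (fun u => Re (f u) * Im (g u))
                           (fun u => Im (f u) * Re (g u)));
      apply (continuous_mult (K := R_AbsRing));
      auto using continuous_Re, continuous_Im.
Qed.

Lemma continuous_Cconj {U : UniformSpace} (f : U -> C) (x : U) :
  continuous f x -> continuous (fun u => Cconj (f u)) x.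
Proof.
  intros Hf. apply continuous_Cpair.
  - now apply continuous_Re.
  - apply (continuous_opp (fun u => Im (f u))). now apply continuous_Im.
Qed.

Lemma continuous_Copp {U : UniformSpace} (f : U -> C) (x : U) :
  continuous f x -> continuous (fun u => (- f u)%C) x.
Proof.
  intros Hf. apply continuous_Cpair.
  - apply (continuous_opp (fun u => Re (f u))). now apply continuous_Re.
  - apply (continuous_opp (fun u => Im (f u))). now apply continuous_Im.
Qed.

Lemma continuous_Cinv {U : UniformSpace} (f : U -> C) (x : U) :
  continuous f x -> f x <> RtoC 0 -> continuous (fun u => (/ f u)%C) x.
Proof.
  intros Hf Hn.
  assert (Hd : continuous (fun u => fst (f u) ^ 2 + snd (f u) ^ 2) x).
  { apply (continuous_plus (fun u => Re (f u) ^ 2) (fun u => Im (f u) ^ 2)).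
    - apply (continuous_ext (fun u => Re (f u) * Re (f u))).
      { intros; simpl; ring. }
      apply (continuous_mult (K := R_AbsRing)); now apply continuous_Re.
    - apply (continuous_ext (fun u => Im (f u) * Im (f u))).
      { intros; simpl; ring. }
      apply (continuous_mult (K := R_AbsRing)); now apply continuous_Im. }
  assert (H0 : fst (f x) ^ 2 + snd (f x) ^ 2 <> 0).
  { intros H. apply Hn. destruct (f x) as [a b]. simpl in H.
    apply injective_projections; simpl; nra. }
  assert (Hi := continuous_comp _ _ x Hd (continuous_Rinv _ H0)).
  apply continuous_Cpair.
  - apply (continuous_mult (K := R_AbsRing)); auto. now apply continuous_Re.
  - apply (continuous_mult (K := R_AbsRing)); auto.
    apply (continuous_opp (fun u => Im (f u))). now apply continuous_Im.
Qed.

Definition cis (t : R) : C := (cos t, sin t).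

Lemma cis_add s t : cis (s + t) = (cis s * cis t)%C.
Proof.
  unfold cis, Cmult; simpl. rewrite cos_plus, sin_plus.
  apply injective_projections; simpl; ring.
Qed.

Lemma cis_opp t : cis (- t) = Cconj (cis t).
Proof. unfold cis, Cconj; simpl. now rewrite cos_neg, sin_neg. Qed.

Lemma cis_0 : cis 0 = RtoC 1.
Proof. unfold cis. now rewrite cos_0, sin_0. Qed.

Lemma Cmod_cis t : Cmod (cis t) = 1.
Proof.
  unfold Cmod, cis; simpl. transitivity (sqrt 1); [ f_equal | apply sqrt_1 ].
  generalize (sin2_cos2 t). unfold Rsqr. lra.
Qed.

Lemma continuous_cis {U : UniformSpace} (f : U -> R) (x : U) :
  continuous f x -> continuous (fun u => cis (f u)) x.
Proof.
  intros Hf. apply continuous_Cpair.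
  - apply (continuous_comp f cos); [ assumption | apply continuous_cos ].
  - apply (continuous_comp f sin); [ assumption | apply continuous_sin ].
Qed.

(** Integrating the components separately reduces complex integrals to real ones. *)
Definition circle_mean (f : R -> C) : C :=
  (RInt (fun t => Re (f t)) 0 (2 * PI) / (2 * PI),
   RInt (fun t => Im (f t)) 0 (2 * PI) / (2 * PI)).

Lemma two_PI_pos : 0 < 2 * PI.
Proof. generalize PI_RGT_0; lra. Qed.

Lemma ex_RInt_all (f : R -> R) a b : (forall t, continuous f t) -> ex_RInt f a b.
Proof. intros H. apply (ex_RInt_continuous f). intros; apply H. Qed.

Lemma circle_mean_ext (f g : R -> C) : (forall t, f t = g t) -> circle_mean f = circle_mean g.
Proof.
  intros H. unfold circle_mean. f_equal; f_equal; apply RInt_ext; intros; now rewrite H.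
Qed.

Lemma circle_mean_plus (f g : R -> C) :
  (forall t, continuous f t) -> (forall t, continuous g t) ->
  circle_mean (fun t => (f t + g t)%C) = (circle_mean f + circle_mean g)%C.
Proof.
  intros Hf Hg. generalize two_PI_pos; intros HP.
  assert (E1 := RInt_plus (fun t => Re (f t)) (fun t => Re (g t)) 0 (2 * PI)
    (ex_RInt_all _ _ _ (fun t => continuous_Re _ _ (Hf t)))
    (ex_RInt_all _ _ _ (fun t => continuous_Re _ _ (Hg t)))).
  assert (E2 := RInt_plus (fun t => Im (f t)) (fun t => Im (g t)) 0 (2 * PI)
    (ex_RInt_all _ _ _ (fun t => continuous_Im _ _ (Hf t)))
    (ex_RInt_all _ _ _ (fun t => continuous_Im _ _ (Hg t)))).
  unfold circle_mean, Cplus; apply injective_projections; cbn [fst snd].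
  - transitivity ((RInt (fun t => Re (f t)) 0 (2 * PI) + RInt (fun t => Re (g t)) 0 (2 * PI)) / (2 * PI)).
    + f_equal. exact E1.
    + field; generalize PI_RGT_0; lra.
  - transitivity ((RInt (fun t => Im (f t)) 0 (2 * PI) + RInt (fun t => Im (g t)) 0 (2 * PI)) / (2 * PI)).
    + f_equal. exact E2.
    + field; generalize PI_RGT_0; lra.
Qed.

Lemma RInt_lin (f g : R -> R) (a b u v : R) :
  (forall t, continuous f t) -> (forall t, continuous g t) ->
  RInt (fun t => u * f t + v * g t) a b = u * RInt f a b + v * RInt g a b.
Proof.
  intros Hf Hg.
  assert (If := RInt_correct _ _ _ (ex_RInt_all f a b Hf)).
  assert (Ig := RInt_correct _ _ _ (ex_RInt_all g a b Hg)).
  apply is_RInt_unique.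
  apply (is_RInt_plus (fun t => u * f t) (fun t => v * g t)).
  - now apply (is_RInt_scal f).
  - now apply (is_RInt_scal g).
Qed.

Lemma circle_mean_scal c (f : R -> C) :
  (forall t, continuous f t) ->
  circle_mean (fun t => (c * f t)%C) = (c * circle_mean f)%C.
Proof.
  intros Hf. generalize two_PI_pos; intros HP.
  assert (HR : forall t, continuous (fun t => Re (f t)) t)
    by (intros; now apply continuous_Re).
  assert (HI : forall t, continuous (fun t => Im (f t)) t)
    by (intros; now apply continuous_Im).
  unfold circle_mean, Cmult; apply injective_projections; cbn [fst snd].
  - transitivity (RInt (fun t => fst c * Re (f t) + (- snd c) * Im (f t)) 0 (2 * PI) / (2 * PI)).
    + f_equal. apply RInt_ext; intros. unfold Re, Im; simpl; ring.
    + rewrite RInt_lin by auto. field; generalize PI_RGT_0; lra.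
  - transitivity (RInt (fun t => fst c * Im (f t) + snd c * Re (f t)) 0 (2 * PI) / (2 * PI)).
    + reflexivity.
    + rewrite RInt_lin by auto. field; generalize PI_RGT_0; lra.
Qed.

Lemma circle_mean_const c : circle_mean (fun _ => c) = c.
Proof.
  unfold circle_mean. rewrite !RInt_const. unfold scal; simpl; unfold mult; simpl.
  generalize PI_RGT_0; intros. destruct c as [a b].
  apply injective_projections; simpl; field; lra.
Qed.

Lemma circle_mean_Re_ge0 (f : R -> C) :
  (forall t, continuous f t) -> (forall t, 0 <= Re (f t)) -> 0 <= Re (circle_mean f).
Proof.
  intros Hf H. generalize two_PI_pos; intros HP. simpl.
  apply Rmult_le_pos; [ | left; now apply Rinv_0_lt_compat ].
  apply RInt_ge_0; [ lra | | auto ].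
  apply ex_RInt_all. intros; now apply continuous_Re.
Qed.

Lemma Re_le_Cmod (c : C) : Re c <= Cmod c.
Proof. apply Rle_trans with (2 := re_le_Cmod c), Rle_abs. Qed.

Lemma rotate_to_Cmod (c : C) :
  exists u : C, Cmod u = 1 /\ (u * c)%C = RtoC (Cmod c).
Proof.
  destruct (Ceq_dec c 0) as [->|Hc].
  - exists (RtoC 1). rewrite Cmod_1, Cmod_0. split; auto. ring.
  - assert (Hm := proj1 (Cmod_gt_0 c) Hc).
    assert (Hm' : RtoC (Cmod c) <> RtoC 0).
    { intros E. apply RtoC_inj in E. lra. }
    exists (Cconj c / Cmod c)%C. split.
    + rewrite Cmod_div, Cmod_conj, Cmod_R, Rabs_pos_eq by (auto; lra). field; lra.
    + transitivity (c * Cconj c / Cmod c)%C.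
      * field; auto.
      * rewrite <- Cmod2_conj, RtoC_pow. field; auto.
Qed.

(** Rotate the mean to the positive real axis, where the bound becomes positivity
    of the mean of a function with nonnegative real part. *)
Lemma Cmod_circle_mean_le (f : R -> C) B :
  (forall t, continuous f t) -> (forall t, Cmod (f t) <= B) -> Cmod (circle_mean f) <= B.
Proof.
  intros Hf H. destruct (rotate_to_Cmod (circle_mean f)) as [u [Hu E]].
  assert (P : 0 <= Re (circle_mean (fun t => (RtoC B + (- u) * f t)%C))).
  { apply circle_mean_Re_ge0.
    - intros t. apply continuous_Cplus; [ apply continuous_const | ].
      apply continuous_Cmult; [ apply continuous_const | auto ].
    - intros t. specialize (H t).
      assert (Q := Re_le_Cmod (u * f t)%C). rewrite Cmod_mult, Hu in Q.
      unfold Re in *; simpl in *; lra. }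
  rewrite circle_mean_plus, circle_mean_const, circle_mean_scal in P.
  - replace (- u * circle_mean f)%C with (- (u * circle_mean f))%C in P by ring.
    rewrite E in P. simpl in P. lra.
  - auto.
  - intros; apply continuous_const.
  - intros; apply continuous_Cmult; [ apply continuous_const | auto ].
Qed.

Definition is_path_derive (f : R -> C) (t : R) (l : C) : Prop :=
  is_derive (fun s => Re (f s)) t (Re l) /\ is_derive (fun s => Im (f s)) t (Im l).

Lemma circle_mean_derive_periodic (f df : R -> C) :
  (forall t, is_path_derive f t (df t)) -> (forall t, continuous df t) ->
  f (2 * PI) = f 0 -> circle_mean df = RtoC 0.
Proof.
  intros Hd Hc E.
  assert (I1 : is_RInt (fun t => Re (df t)) 0 (2 * PI) (minus (Re (f (2 * PI))) (Re (f 0)))).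
  { apply (is_RInt_derive (fun t => Re (f t))); intros.
    - apply Hd.
    - now apply continuous_Re. }
  assert (I2 : is_RInt (fun t => Im (df t)) 0 (2 * PI) (minus (Im (f (2 * PI))) (Im (f 0)))).
  { apply (is_RInt_derive (fun t => Im (f t))); intros.
    - apply Hd.
    - now apply continuous_Im. }
  unfold circle_mean. rewrite (is_RInt_unique _ _ _ _ I1), (is_RInt_unique _ _ _ _ I2), E.
  rewrite !minus_eq_zero. unfold zero; simpl.
  apply injective_projections; simpl; field; generalize PI_RGT_0; lra.
Qed.

Lemma is_path_derive_cis k t :
  is_path_derive (fun t => cis (k * t)) t (RtoC k * Ci * cis (k * t))%C.
Proof.
  split; unfold cis, Re, Im; simpl.
  - auto_derive; [ exact I | ring ].
  - auto_derive; [ exact I | ring ].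
Qed.

Lemma cis_2PI k : cis (INR k * (2 * PI)) = RtoC 1.
Proof.
  induction k as [|k IH].
  - simpl. rewrite Rmult_0_l. apply cis_0.
  - rewrite S_INR, Rmult_plus_distr_r, cis_add, IH, Rmult_1_l.
    unfold cis. rewrite cos_2PI, sin_2PI. apply injective_projections; simpl; ring.
Qed.

(** [cis (k t)] is a derivative of a periodic function. *)
Lemma circle_mean_cis k :
  k <> 0 -> cis (k * (2 * PI)) = RtoC 1 ->
  circle_mean (fun t => cis (k * t)) = RtoC 0.
Proof.
  intros Hk Hp.
  assert (Hc : forall t, continuous (fun t => cis (k * t)) t).
  { intros t. apply continuous_cis, (continuous_mult (K := R_AbsRing)).
    - apply continuous_const.
    - apply continuous_id. }
  assert (E : circle_mean (fun t => (RtoC k * Ci * cis (k * t))%C) = RtoC 0).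
  { apply (circle_mean_derive_periodic (fun t => cis (k * t))).
    - intros t. apply is_path_derive_cis.
    - intros t. apply continuous_Cmult; [ apply continuous_const | auto ].
    - rewrite Hp, Rmult_0_r, cis_0. reflexivity. }
  rewrite circle_mean_scal in E by auto.
  assert (HC : (RtoC k * Ci)%C <> RtoC 0).
  { apply Cmult_neq_0.
    - intros H. apply RtoC_inj in H. lra.
    - intros H. apply (f_equal snd) in H. simpl in H. lra. }
  replace (circle_mean (fun t => cis (k * t)))
    with (/ (k * Ci) * (k * Ci * circle_mean (fun t => cis (k * t))))%C
    by (field; split; auto; intros H; apply HC; rewrite H; ring).
  rewrite E. ring.
Qed.

Lemma Cpow_cis n t : (cis t ^ n)%C = cis (INR n * t).
Proof.
  induction n as [|n IH].
  - simpl. now rewrite Rmult_0_l, cis_0.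
  - rewrite Cpow_S, IH, <- cis_add, S_INR. f_equal. ring.
Qed.

Lemma circle_mean_cis_pow n : circle_mean (fun t => (cis t ^ S n)%C) = RtoC 0.
Proof.
  rewrite (circle_mean_ext _ (fun t => cis (INR (S n) * t))) by (intros; apply Cpow_cis).
  apply circle_mean_cis; [ now apply not_0_INR | apply cis_2PI ].
Qed.

Lemma circle_mean_cis_conj_pow n : circle_mean (fun t => (Cconj (cis t) ^ S n)%C) = RtoC 0.
Proof.
  rewrite (circle_mean_ext _ (fun t => cis (- INR (S n) * t))).
  - apply circle_mean_cis.
    + apply Ropp_neq_0_compat. now apply not_0_INR.
    + rewrite Ropp_mult_distr_l_reverse, cis_opp, cis_2PI.
      apply injective_projections; simpl; ring.
  - intros t. rewrite <- Cpow_conj, Cpow_cis, <- cis_opp. f_equal. ring.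
Qed.

Lemma cis_mul_conj t : (cis t * Cconj (cis t))%C = RtoC 1.
Proof. rewrite <- Cmod2_conj, Cmod_cis. f_equal. ring. Qed.

Lemma continuous_Cpow {U : UniformSpace} (f : U -> C) n (x : U) :
  continuous f x -> continuous (fun u => (f u ^ n)%C) x.
Proof.
  intros Hf. induction n as [|n IH]; simpl.
  - apply continuous_const.
  - now apply continuous_Cmult.
Qed.

(** * Complex differentiability along real paths *)

Lemma ball_norm_Cmod (x y : C) (e : R) :
  @ball_norm R_AbsRing C_R_NormedModule x e y <-> Cmod (y - x) < e.
Proof. rewrite Cmod_norm. split; exact (fun H => H). Qed.

Lemma continuous_C_eps (f : C -> C) (z : C) :
  continuous f z <->
  forall eps : posreal, exists d : posreal, forall y : C,
    Cmod (y - z) < d -> Cmod (f y - f z) < eps.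
Proof.
  split; intros H.
  - intros eps.
    assert (L : locally (f z) (fun v => Cmod (v - f z) < eps)).
    { apply (locally_le_locally_norm (K := R_AbsRing) (V := C_R_NormedModule)).
      exists eps. intros y Hy. now apply ball_norm_Cmod. }
    apply H in L.
    apply (locally_norm_le_locally (K := R_AbsRing) (V := C_R_NormedModule)) in L.
    destruct L as [d Hd]. exists d. intros y Hy. apply Hd. now apply ball_norm_Cmod.
  - intros P HP.
    apply (locally_norm_le_locally (K := R_AbsRing) (V := C_R_NormedModule)) in HP.
    destruct HP as [eps He]. destruct (H eps) as [d Hd].
    apply (locally_le_locally_norm (K := R_AbsRing) (V := C_R_NormedModule)).
    exists d. intros y Hy. apply He, ball_norm_Cmod, Hd. now apply ball_norm_Cmod.
Qed.

(** The increment form of complex differentiability.  [is_derive] takes scalars and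
    values in two different normed-space structures on C; the form with [Cmod]
    keeps products and dilations free of that distinction. *)
Definition Cdiff (f : C -> C) (z l : C) : Prop :=
  forall eps : R, 0 < eps -> exists d : R, 0 < d /\ forall y : C,
    Cmod (y - z) < d -> Cmod (f y - f z - (y - z) * l) <= eps * Cmod (y - z).

Lemma is_derive_Cdiff f z l :
  @is_derive C_AbsRing C_NormedModule f z l -> Cdiff f z l.
Proof.
  intros [_ H] eps He. specialize (H z (fun P HP => HP) (mkposreal eps He)).
  destruct H as [d Hd]. exists d. split; [ apply cond_pos | ].
  intros y Hy. apply Hd. exact Hy.
Qed.

Lemma Cdiff_is_derive f z l :
  Cdiff f z l -> @is_derive C_AbsRing C_NormedModule f z l.
Proof.
  intros H. split; [ apply is_linear_scal_l | ].
  intros x Hx eps.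
  apply (is_filter_lim_locally_unique (V := AbsRing_NormedModule C_AbsRing) z x) in Hx.
  subst x. destruct (H eps (cond_pos eps)) as [d [Hd0 Hd]].
  exists (mkposreal d Hd0). intros y Hy. apply Hd. exact Hy.
Qed.

Lemma Cdiff_continuous f z l : Cdiff f z l -> continuous f z.
Proof.
  intros H. apply continuous_C_eps. intros eps.
  destruct (H 1 Rlt_0_1) as [d [Hd0 Hd]].
  assert (Hl := Cmod_ge_0 l).
  assert (Hm : 0 < Rmin d (eps / (Cmod l + 2))).
  { apply Rmin_pos; auto. apply Rdiv_lt_0_compat; [ apply cond_pos | lra ]. }
  exists (mkposreal _ Hm). simpl. intros y Hy.
  assert (H1 : Cmod (y - z) < d) by (eapply Rlt_le_trans, Rmin_l; exact Hy).
  assert (H2 : Cmod (y - z) < eps / (Cmod l + 2)) by (eapply Rlt_le_trans, Rmin_r; exact Hy).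
  specialize (Hd y H1).
  apply Rlt_div_r in H2; [ | lra ].
  replace (f y - f z)%C with ((f y - f z - (y - z) * l) + (y - z) * l)%C by ring.
  eapply Rle_lt_trans; [ apply Cmod_triangle | ]. rewrite Cmod_mult.
  generalize (Cmod_ge_0 (y - z)); nra.
Qed.

Lemma Cdiff_plus f g z l m :
  Cdiff f z l -> Cdiff g z m -> Cdiff (fun z => f z + g z)%C z (l + m)%C.
Proof.
  intros Hf Hg eps He.
  destruct (Hf (eps / 2)) as [d1 [P1 H1]]; [ lra | ].
  destruct (Hg (eps / 2)) as [d2 [P2 H2]]; [ lra | ].
  exists (Rmin d1 d2). split; [ now apply Rmin_pos | ]. intros y Hy.
  specialize (H1 y (Rlt_le_trans _ _ _ Hy (Rmin_l _ _))).
  specialize (H2 y (Rlt_le_trans _ _ _ Hy (Rmin_r _ _))).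
  replace (f y + g y - (f z + g z) - (y - z) * (l + m))%C
    with ((f y - f z - (y - z) * l) + (g y - g z - (y - z) * m))%C by ring.
  eapply Rle_trans; [ apply Cmod_triangle | ]. lra.
Qed.

Lemma Cdiff_scal c f z l : Cdiff f z l -> Cdiff (fun z => c * f z)%C z (c * l)%C.
Proof.
  intros Hf eps He. assert (Hc := Cmod_ge_0 c).
  destruct (Hf (eps / (Cmod c + 1))) as [d [P H]].
  { apply Rdiv_lt_0_compat; lra. }
  exists d. split; auto. intros y Hy. specialize (H y Hy).
  replace (c * f y - c * f z - (y - z) * (c * l))%C
    with (c * (f y - f z - (y - z) * l))%C by ring.
  rewrite Cmod_mult.
  apply Rle_trans with (Cmod c * (eps / (Cmod c + 1) * Cmod (y - z))).
  { now apply Rmult_le_compat_l. }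
  replace (Cmod c * (eps / (Cmod c + 1) * Cmod (y - z)))
    with (eps * Cmod (y - z) * (Cmod c / (Cmod c + 1))) by (field; lra).
  rewrite <- (Rmult_1_r (eps * Cmod (y - z))) at 2.
  apply Rmult_le_compat_l.
  - generalize (Cmod_ge_0 (y - z)); nra.
  - apply Rle_div_l; lra.
Qed.

Lemma Cdiff_const c z : Cdiff (fun _ => c) z (RtoC 0).
Proof.
  intros eps He. exists 1. split; [ lra | ]. intros y _.
  replace (c - c - (y - z) * 0)%C with (RtoC 0) by ring. rewrite Cmod_0.
  generalize (Cmod_ge_0 (y - z)); nra.
Qed.

Lemma Cdiff_id z : Cdiff (fun z => z) z (RtoC 1).
Proof.
  intros eps He. exists 1. split; [ lra | ]. intros y _.
  replace (y - z - (y - z) * 1)%C with (RtoC 0) by ring. rewrite Cmod_0.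
  generalize (Cmod_ge_0 (y - z)); nra.
Qed.

Lemma Cdiff_mul_id f z l :
  Cdiff f z l -> Cdiff (fun z => z * f z)%C z (f z + z * l)%C.
Proof.
  intros Hf eps He.
  assert (Hc := proj1 (continuous_C_eps f z) (Cdiff_continuous f z l Hf)).
  destruct (Cdiff_scal z f z l Hf (eps / 2)) as [d1 [P1 H1]]; [ lra | ].
  assert (He2 : 0 < eps / 2) by lra.
  destruct (Hc (mkposreal _ He2)) as [d2 H2]. simpl in H2.
  exists (Rmin d1 d2). split; [ apply Rmin_pos; auto; apply cond_pos | ].
  intros y Hy.
  specialize (H1 y (Rlt_le_trans _ _ _ Hy (Rmin_l _ _))).
  specialize (H2 y (Rlt_le_trans _ _ _ Hy (Rmin_r _ _))).
  replace (y * f y - z * f z - (y - z) * (f z + z * l))%C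
    with ((z * f y - z * f z - (y - z) * (z * l)) + (y - z) * (f y - f z))%C by ring.
  eapply Rle_trans; [ apply Cmod_triangle | ]. rewrite (Cmod_mult (y - z)).
  generalize (Cmod_ge_0 (y - z)); nra.
Qed.

Lemma Cdiff_dilation (r : R) f z l :
  0 < r -> Cdiff f (r * z)%C l -> Cdiff (fun z => f (r * z)%C) z (r * l)%C.
Proof.
  intros Hr Hf eps He.
  destruct (Hf (eps / r)) as [d [P H]]; [ now apply Rdiv_lt_0_compat | ].
  exists (d / r). split; [ now apply Rdiv_lt_0_compat | ]. intros y Hy.
  assert (E : Cmod (r * y - r * z) = r * Cmod (y - z)).
  { replace (r * y - r * z)%C with (r * (y - z))%C by ring.
    now rewrite Cmod_mult, Cmod_R, Rabs_pos_eq by lra. }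
  apply Rlt_div_r in Hy; auto.
  specialize (H (r * y)%C). rewrite E in H.
  replace (f (r * y) - f (r * z) - (y - z) * (r * l))%C
    with (f (r * y) - f (r * z) - (r * y - r * z) * l)%C by ring.
  eapply Rle_trans; [ apply H; lra | ]. right. field. lra.
Qed.

Lemma Cdiff_unique f z l m : Cdiff f z l -> Cdiff f z m -> l = m.
Proof.
  intros Hl Hm.
  destruct (Ceq_dec (l - m)%C 0) as [E|N].
  { replace l with ((l - m) + m)%C by ring. rewrite E. ring. }
  exfalso. apply Cmod_gt_0 in N.
  destruct (Hl (Cmod (l - m) / 4)) as [d1 [P1 H1]]; [ lra | ].
  destruct (Hm (Cmod (l - m) / 4)) as [d2 [P2 H2]]; [ lra | ].
  set (d := Rmin d1 d2 / 2).
  assert (Pd : 0 < Rmin d1 d2) by now apply Rmin_pos.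
  assert (E : Cmod (z + d - z) = d).
  { replace (z + d - z)%C with (RtoC d) by ring. rewrite Cmod_R. apply Rabs_pos_eq.
    unfold d; lra. }
  assert (Q1 := Rmin_l d1 d2). assert (Q2 := Rmin_r d1 d2).
  specialize (H1 (z + d)%C). specialize (H2 (z + d)%C).
  rewrite E in H1, H2.
  assert (T : Cmod (d * (l - m)) <= Cmod (l - m) / 4 * d + Cmod (l - m) / 4 * d).
  { replace (d * (l - m))%C
      with ((f (z + d) - f z - (z + d - z) * m)
            + - (f (z + d) - f z - (z + d - z) * l))%C by ring.
    eapply Rle_trans; [ apply Cmod_triangle | ]. rewrite Cmod_opp.
    apply Rplus_le_compat; [ apply H2 | apply H1 ]; unfold d; lra. }
  rewrite Cmod_mult, Cmod_R, Rabs_pos_eq in T by (unfold d; lra).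
  assert (0 < d) by (unfold d; lra). nra.
Qed.

(** A complex derivative is a real differential on the plane, which is what the
    chain rule along a real path needs. *)
Lemma Cdiff_filterdiff_Re f z l :
  Cdiff f z l ->
  @filterdiff R_AbsRing C_R_NormedModule R_NormedModule
    (fun p : C => Re (f p)) (locally z) (fun p : C => Re (p * l)%C).
Proof.
  intros H. split.
  - split.
    + intros x y. simpl. unfold plus; simpl. ring.
    + intros k x. simpl. unfold scal; simpl; unfold mult; simpl. ring.
    + exists (Cmod l + 1). split; [ generalize (Cmod_ge_0 l); lra | ].
      intros x. apply Rle_trans with (Cmod (x * l)); [ apply re_le_Cmod | ].
      rewrite Cmod_mult, Cmod_norm.
      change (norm x) with
        (@norm R_AbsRing (prod_NormedModule _ R_NormedModule R_NormedModule) x).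
      rewrite <- !Cmod_norm.
      generalize (Cmod_ge_0 x) (Cmod_ge_0 l); nra.
  - intros x Hx eps.
    apply (is_filter_lim_locally_unique (V := C_R_NormedModule) z x) in Hx. rewrite <- Hx. clear x Hx.
    destruct (H eps (cond_pos eps)) as [d [Hd0 Hd]].
    apply (locally_le_locally_norm (K := R_AbsRing) (V := C_R_NormedModule)).
    exists (mkposreal d Hd0). intros y Hy. apply ball_norm_Cmod in Hy.
    change (norm (minus y z)) with
      (@norm R_AbsRing (prod_NormedModule _ R_NormedModule R_NormedModule) (y - z)%C).
    rewrite <- Cmod_norm.
    apply Rle_trans with (2 := Hd y Hy).
    apply (re_le_Cmod (f y - f z - (y - z) * l)).
Qed.

Lemma path_derive_filterdiff (g : R -> C) t l :
  is_path_derive g t l ->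
  @filterdiff R_AbsRing R_NormedModule C_R_NormedModule g (locally t)
    (fun s => (s * Re l, s * Im l)).
Proof.
  intros [H1 H2].
  apply (filterdiff_ext (fun s => (Re (g s), Im (g s)))).
  { intros s. now destruct (g s). }
  apply (filterdiff_comp'_2 (fun s => Re (g s)) (fun s => Im (g s))
     (fun a b => (a, b) : C) t (fun s => s * Re l) (fun s => s * Im l)
     (fun a b => (a, b)) H1 H2).
  apply (filterdiff_ext (fun p => p)).
  { now intros [a b]. }
  apply (filterdiff_ext_lin _ (fun p => p)).
  { apply filterdiff_id. }
  now intros [a b].
Qed.

Lemma is_derive_Re_comp f (g : R -> C) t l m :
  is_path_derive g t l -> Cdiff f (g t) m ->
  is_derive (fun s => Re (f (g s))) t (Re (l * m)%C).
Proof.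
  intros Hg Hf.
  apply path_derive_filterdiff in Hg. apply Cdiff_filterdiff_Re in Hf.
  assert (H := filterdiff_comp' _ _ _ _ _ Hg Hf).
  apply (filterdiff_ext_lin _ _ _ H).
  intros s. unfold scal; simpl; unfold mult; simpl. unfold Re, Im; ring.
Qed.

(** The imaginary part of f is the real part of -i f. *)
Lemma is_path_derive_comp f (g : R -> C) t l m :
  is_path_derive g t l -> Cdiff f (g t) m ->
  is_path_derive (fun s => f (g s)) t (l * m)%C.
Proof.
  intros Hg Hf. split.
  - now apply is_derive_Re_comp.
  - apply (is_derive_ext (fun s => Re ((- Ci) * f (g s))%C)).
    { intros s. unfold Re, Im; simpl. ring. }
    replace (Im (l * m)%C) with (Re (l * (- Ci * m))%C).
    + apply (is_derive_Re_comp (fun p => (- Ci) * f p)%C); auto.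
      now apply Cdiff_scal.
    + unfold Re, Im; simpl. ring.
Qed.

(** * Cauchy's formula by shrinking the circle *)

(** Continuity of the derivative is part of the notion: it permits
    differentiation under the integral sign. *)
Definition holo (rho : R) (f f' : C -> C) : Prop :=
  forall z, Cmod z < rho -> Cdiff f z (f' z) /\ continuous f' z.

Lemma holo_continuous rho f f' z : holo rho f f' -> Cmod z < rho -> continuous f z.
Proof. intros H Hz. exact (Cdiff_continuous _ _ _ (proj1 (H z Hz))). Qed.

Lemma holo_scal rho c f f' :
  holo rho f f' -> holo rho (fun z => c * f z)%C (fun z => c * f' z)%C.
Proof.
  intros H z Hz. destruct (H z Hz) as [H1 H2]. split.
  - now apply Cdiff_scal.
  - apply continuous_Cmult; [ apply continuous_const | assumption ].
Qed.

Lemma holo_mul_id rho f f' :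
  holo rho f f' -> holo rho (fun z => z * f z)%C (fun z => f z + z * f' z)%C.
Proof.
  intros H z Hz. destruct (H z Hz) as [H1 H2]. split.
  - now apply Cdiff_mul_id.
  - apply continuous_Cplus.
    + now apply (holo_continuous rho f f').
    + apply continuous_Cmult; [ apply continuous_id | assumption ].
Qed.

Lemma cis_sub_neq_0 z t : Cmod z < 1 -> (cis t - z)%C <> RtoC 0.
Proof.
  intros Hz E. assert (cis t = z) by (replace z with (z + (cis t - z))%C by (rewrite E; ring); ring).
  generalize (Cmod_cis t). rewrite H. lra.
Qed.

Definition segment (z : C) (u t : R) : C := (z + u * (cis t - z))%C.

(** Letting u run slightly beyond [0, 1] gives room to differentiate at both ends. *)
Lemma Cmod_segment z u t eta :
  Cmod z < 1 -> - eta < u < 1 + eta -> 0 < eta -> Cmod (segment z u t) <= 1 + 2 * eta.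
Proof.
  intros Hz Hu He. unfold segment.
  replace (z + u * (cis t - z))%C with (RtoC (1 - u) * z + u * cis t)%C
    by (rewrite RtoC_minus; ring).
  eapply Rle_trans; [ apply Cmod_triangle | ].
  rewrite !Cmod_mult, !Cmod_R, Cmod_cis.
  assert (Rabs (1 - u) * Cmod z <= Rabs (1 - u)).
  { rewrite <- (Rmult_1_r (Rabs (1 - u))) at 2. apply Rmult_le_compat_l; [ apply Rabs_pos | lra ]. }
  unfold Rabs in *. destruct (Rcase_abs u), (Rcase_abs (1 - u)); lra.
Qed.

Lemma continuous_segment z (p : R * R) :
  continuous (fun p : R * R => segment z (fst p) (snd p)) p.
Proof.
  unfold segment. apply continuous_Cplus; [ apply continuous_const | ].
  apply continuous_Cmult.
  - apply continuous_Cpair; [ | apply continuous_const ].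
    destruct p. apply continuous_fst.
  - apply continuous_Cplus; [ | apply continuous_const ].
    apply continuous_cis. destruct p. apply continuous_snd.
Qed.

Lemma continuous_segment_angle z u t : continuous (fun t => segment z u t) t.
Proof.
  unfold segment. apply continuous_Cplus; [ apply continuous_const | ].
  apply continuous_Cmult; [ apply continuous_const | ].
  apply continuous_Cplus; [ | apply continuous_const ].
  apply continuous_cis, continuous_id.
Qed.

Lemma path_derive_segment_length z u t :
  is_path_derive (fun u => segment z u t) u (cis t - z)%C.
Proof.
  destruct z as [a b]. split; unfold segment, cis, Re, Im; simpl.
  - auto_derive; [ exact I | ring ].
  - auto_derive; [ exact I | ring ].
Qed.

Lemma path_derive_segment_angle z u t :
  is_path_derive (fun t => segment z u t) t (u * Ci * cis t)%C.
Proof.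
  destruct z as [a b]. split; unfold segment, cis, Re, Im; simpl.
  - auto_derive; [ exact I | ring ].
  - auto_derive; [ exact I | ring ].
Qed.

(** Up to the constant factor i u, the integrand is the derivative in t of
    f along the closed curve t |-> z + u (cis t - z).  For u = 0 the curve
    degenerates and the mean is that of a multiple of [cis]. *)
Lemma circle_mean_derivative_circle rho f f' z u :
  holo rho f f' -> (forall t, Cmod (segment z u t) < rho) ->
  circle_mean (fun t => (f' (segment z u t) * cis t)%C) = RtoC 0.
Proof.
  intros Hf Hs.
  assert (Hc : forall t, continuous (fun t => (f' (segment z u t) * cis t)%C) t).
  { intros t. apply continuous_Cmult.
    - apply (continuous_comp (fun t => segment z u t) f').
      + apply continuous_segment_angle.
      + now apply Hf.
    - apply continuous_cis, continuous_id. }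
  assert (Hi : Ci <> RtoC 0).
  { intros H. apply (f_equal snd) in H. simpl in H. lra. }
  destruct (Req_dec u 0) as [->|Hu].
  - apply (circle_mean_derive_periodic (fun t => f' z * (- Ci) * cis (1 * t))%C); auto.
    + intros t.
      assert (H := is_path_derive_comp (fun p => f' z * (- Ci) * p)%C
                     (fun t => cis (1 * t)) t _ _ (is_path_derive_cis 1 t)
                     (Cdiff_scal (f' z * (- Ci))%C (fun p => p) _ 1 (Cdiff_id _))).
      replace (f' (segment z 0 t) * cis t)%C with
        (1 * Ci * cis (1 * t) * (f' z * - Ci * 1))%C; [ exact H | ].
      rewrite Rmult_1_l.
        replace (segment z 0 t) with z by (unfold segment; ring).
        transitivity (- (Ci * Ci) * (f' z * cis t))%C; [ ring | ].
        replace (Ci * Ci)%C with (- (1))%C by (apply injective_projections; simpl; ring).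
        ring.
    + unfold cis. rewrite Rmult_0_r, Rmult_1_l, cos_2PI, sin_2PI, cos_0, sin_0. reflexivity.
  - assert (Hu' : RtoC u <> RtoC 0) by (intros E; apply RtoC_inj in E; lra).
    apply (circle_mean_derive_periodic (fun t => / (u * Ci) * f (segment z u t))%C); auto.
    + intros t.
      assert (H := is_path_derive_comp (fun p => / (u * Ci) * f p)%C
                     (fun t => segment z u t) t _ _ (path_derive_segment_angle z u t)
                     (Cdiff_scal _ f _ _ (proj1 (Hf _ (Hs t))))).
      replace (f' (segment z u t) * cis t)%C with
        (u * Ci * cis t * (/ (u * Ci) * f' (segment z u t)))%C; [ exact H | ].
      field; auto.
    + unfold segment, cis. rewrite cos_2PI, sin_2PI, cos_0, sin_0. reflexivity.
Qed.

Definition cauchy_kernel (z : C) (t : R) : C := (cis t / (cis t - z))%C.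

Lemma continuous_cauchy_kernel z t :
  Cmod z < 1 -> continuous (cauchy_kernel z) t.
Proof.
  intros Hz. unfold cauchy_kernel, Cdiv.
  apply continuous_Cmult; [ apply continuous_cis, continuous_id | ].
  apply (continuous_Cinv (fun t => cis t - z)%C).
  - apply continuous_Cplus; [ apply continuous_cis, continuous_id | apply continuous_const ].
  - now apply cis_sub_neq_0.
Qed.

(** Contract the unit circle to z along segments.  The factor cis t - z
    produced by the chain rule cancels the pole of the kernel, so the derivative
    in u of the mean is [circle_mean_derivative_circle], that is 0. *)
Lemma homotopy_Re rho f f' z :
  1 < rho -> Cmod z < 1 -> holo rho f f' ->
  Re (circle_mean (fun t => (f (segment z 0 t) * cauchy_kernel z t)%C)) =
  Re (circle_mean (fun t => (f (segment z 1 t) * cauchy_kernel z t)%C)).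
Proof.
  intros Hr Hz Hf.
  set (eta := (rho - 1) / 4).
  assert (He : 0 < eta) by (unfold eta; lra).
  assert (Hs : forall u t, - eta < u < 1 + eta -> Cmod (segment z u t) < rho).
  { intros u t Hu. eapply Rle_lt_trans; [ apply (Cmod_segment z u t eta) | ]; auto.
    unfold eta; lra. }
  set (F := fun u t => Re (f (segment z u t) * cauchy_kernel z t)%C).
  set (D := fun u t => Re (f' (segment z u t) * cis t)%C).
  assert (HF : forall u t, - eta < u < 1 + eta ->
               is_derive (fun u => F u t) u (D u t)).
  { intros u t Hu. unfold F, D.
    apply (is_derive_ext (fun u => Re (cauchy_kernel z t * f (segment z u t))%C)).
    { intros x. f_equal. ring. }
    replace (f' (segment z u t) * cis t)%C
      with ((cis t - z) * (cauchy_kernel z t * f' (segment z u t)))%C.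
    - apply (is_derive_Re_comp (fun p => cauchy_kernel z t * f p)%C (fun u => segment z u t)).
      + apply path_derive_segment_length.
      + apply Cdiff_scal. now apply Hf, Hs.
    - unfold cauchy_kernel. field. now apply cis_sub_neq_0. }
  assert (HC : forall u, - eta < u < 1 + eta -> forall t, continuous (fun t => F u t) t).
  { intros u Hu t. apply continuous_Re, continuous_Cmult.
    - apply (continuous_comp (fun t => segment z u t) f).
      + apply continuous_segment_angle.
      + now apply (holo_continuous rho f f'), Hs.
    - now apply continuous_cauchy_kernel. }
  assert (Hloc : forall x, 0 <= x <= 1 -> locally x (fun u => - eta < u < 1 + eta)).
  { intros x Hx. exists (mkposreal eta He). intros y Hy.
    unfold ball in Hy; simpl in Hy; unfold AbsRing_ball in Hy; simpl in Hy.
    unfold abs, minus, plus, opp in Hy; simpl in Hy.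
    apply Rabs_def2 in Hy. lra. }
  assert (HI : RInt (fun t => F 0 t) 0 (2 * PI) = RInt (fun t => F 1 t) 0 (2 * PI)).
  { apply (eq_is_derive (fun u => RInt (fun t => F u t) 0 (2 * PI))); [ | lra ].
    intros u Hu.
    assert (Hu' : - eta < u < 1 + eta) by lra.
    assert (E0 : RInt (fun t => Derive (fun u => F u t) u) 0 (2 * PI) = 0);
      [ | assert (Dp : is_derive (fun u => RInt (fun t => F u t) 0 (2 * PI)) u
                        (RInt (fun t => Derive (fun u => F u t) u) 0 (2 * PI)));
          [ | rewrite E0 in Dp; exact Dp ] ].
    - rewrite (RInt_ext _ (fun t => D u t)).
      2:{ intros t _. now apply is_derive_unique, HF. }
      assert (E := circle_mean_derivative_circle rho f f' z u Hf (fun t => Hs u t Hu')).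
      apply (f_equal Re) in E. unfold circle_mean, Re at 1 in E. simpl in E.
      apply (Rmult_eq_compat_r (2 * PI)) in E.
      unfold Rdiv in E. rewrite Rmult_assoc, Rinv_l, Rmult_1_r, Rmult_0_l in E.
      + exact E.
      + generalize PI_RGT_0; lra.
    - apply (is_derive_RInt_param F).
      + apply (filter_imp _ _ (fun x Hx t _ => ex_intro _ _ (HF x t Hx)) (Hloc u Hu)).
      + intros t _.
        apply (continuity_2d_pt_ext_loc D).
        * destruct (Hloc u Hu) as [d Hd]. exists d. intros x v Hx _.
          symmetry. apply is_derive_unique, HF. apply Hd. exact Hx.
        * apply continuity_2d_pt_filterlim. unfold D.
          apply (continuous_Re (fun p : R * R => (f' (segment z (fst p) (snd p)) * cis (snd p))%C) (u, t)).
          apply continuous_Cmult.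
          -- apply (continuous_comp (fun p => segment z (fst p) (snd p)) f').
             ++ apply continuous_segment.
             ++ apply Hf, Hs, Hu'.
          -- apply continuous_cis, continuous_snd.
      + apply (filter_imp _ _ (fun x Hx => ex_RInt_all _ _ _ (HC x Hx)) (Hloc u Hu)). }
  unfold circle_mean, Re at 1 3. simpl. f_equal. exact HI.
Qed.

Lemma cauchy_homotopy rho f f' z :
  1 < rho -> Cmod z < 1 -> holo rho f f' ->
  circle_mean (fun t => (f (cis t) * cauchy_kernel z t)%C) =
  (f z * circle_mean (cauchy_kernel z))%C.
Proof.
  intros Hr Hz Hf.
  assert (Hk : forall t, continuous (cauchy_kernel z) t)
    by (intros; now apply continuous_cauchy_kernel).
  assert (H1 : forall t, segment z 1 t = cis t) by (intros; unfold segment; ring).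
  assert (H0 : forall t, segment z 0 t = z) by (intros; unfold segment; ring).
  assert (Hcc : forall t, continuous (fun t => (f (cis t) * cauchy_kernel z t)%C) t).
  { intros t. apply continuous_Cmult; auto.
    apply (continuous_comp cis f).
    - apply continuous_cis, continuous_id.
    - apply (holo_continuous rho f f'); auto. rewrite Cmod_cis; lra. }
  rewrite <- circle_mean_scal by auto.
  assert (E1 := homotopy_Re rho f f' z Hr Hz Hf).
  assert (E2 := homotopy_Re rho _ _ z Hr Hz (holo_scal rho (- Ci)%C f f' Hf)).
  cbv beta in E2.
  rewrite (circle_mean_ext (fun t => f (segment z 0 t) * cauchy_kernel z t)%C
             (fun t => f z * cauchy_kernel z t)%C) in E1 by (intros; now rewrite H0).
  rewrite (circle_mean_ext (fun t => f (segment z 1 t) * cauchy_kernel z t)%C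
             (fun t => f (cis t) * cauchy_kernel z t)%C) in E1 by (intros; now rewrite H1).
  set (A := circle_mean (fun t => f (cis t) * cauchy_kernel z t)%C) in *.
  set (B := circle_mean (fun t => f z * cauchy_kernel z t)%C) in *.
  assert (E3 : Re (- Ci * B)%C = Re (- Ci * A)%C).
  { unfold A, B.
    rewrite <- (circle_mean_scal (- Ci) (fun t => f z * cauchy_kernel z t)%C)
      by (intros; apply continuous_Cmult; [ apply continuous_const | auto ]).
    rewrite <- (circle_mean_scal (- Ci) (fun t => f (cis t) * cauchy_kernel z t)%C) by auto.
    transitivity (Re (circle_mean (fun t => (- Ci * f (segment z 0 t)) * cauchy_kernel z t)%C)).
    - f_equal. apply circle_mean_ext; intros. rewrite H0. ring.
    - rewrite E2. f_equal. apply circle_mean_ext; intros. rewrite H1. ring. }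
  clearbody A B. clear E2. destruct A, B. unfold Re, Ci in E1, E3.
  simpl in E1, E3. apply injective_projections; simpl; lra.
Qed.

(** The dispatch is on the syntactic head because unification would otherwise unfold
    the complex operations into pairs of real expressions. *)
Ltac cont :=
  first
  [ match goal with
    | H : forall t, continuous ?g t |- continuous ?g _ => exact (H _)
    | H : forall t, continuous ?g t |- continuous (fun x => ?g x) _ => exact (H _)
    end
  | lazymatch goal with
    | |- continuous (fun _ => (_ + _)%C) _ => apply continuous_Cplus; cont
    | |- continuous (fun _ => (_ * _)%C) _ => apply continuous_Cmult; cont
    | |- continuous (fun _ => (_ ^ _)%C) _ => apply continuous_Cpow; cont
    | |- continuous (fun _ => Cconj _) _ => apply continuous_Cconj; cont
    | |- continuous (fun _ => cis _) _ => apply continuous_cis; cont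
    | |- continuous cis _ => apply (continuous_cis (fun t => t)), continuous_id
    | |- continuous (cauchy_kernel _) _ => now apply continuous_cauchy_kernel
    | |- continuous (fun _ => cauchy_kernel _ _) _ => now apply continuous_cauchy_kernel
    | |- continuous (fun t => t) _ => apply continuous_id
    | |- continuous (fun _ => ?c) _ => apply continuous_const
    end ].

(** The n-th Taylor coefficient, as an integral of boundary values. *)
Definition circle_coef (f : R -> C) (n : nat) : C :=
  circle_mean (fun t => (f t * Cconj (cis t) ^ n)%C).

(** The n-th coefficient of the Cauchy integral's expansion and everything beyond:
    for the boundary values of an analytic function this is the sum of c_(n+k) z^k over k >= 0. *)
Definition cauchy_tail (f : R -> C) (z : C) (n : nat) : C :=
  circle_mean (fun t => (f t * Cconj (cis t) ^ n * cauchy_kernel z t)%C).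

(** On the circle, w / (w - z) = 1 + z conj(w) (w / (w - z)). *)
Lemma cauchy_tail_S (f : R -> C) z n :
  (forall t, continuous f t) -> Cmod z < 1 ->
  cauchy_tail f z n = (circle_coef f n + z * cauchy_tail f z (S n))%C.
Proof.
  intros Hf Hz. unfold cauchy_tail, circle_coef.
  rewrite <- circle_mean_scal, <- circle_mean_plus by (intros; cont).
  apply circle_mean_ext. intros t. rewrite Cpow_S.
  unfold cauchy_kernel.
  assert (Hn := cis_sub_neq_0 z t Hz).
  transitivity (f t * Cconj (cis t) ^ n * (1 + z * ((cis t * Cconj (cis t)) / (cis t - z))))%C.
  - rewrite cis_mul_conj. field. auto.
  - field. auto.
Qed.

Lemma Cmod_kernel_le z t : Cmod z < 1 -> Cmod (cauchy_kernel z t) <= / (1 - Cmod z).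
Proof.
  intros Hz. unfold cauchy_kernel.
  rewrite Cmod_div, Cmod_cis by now apply cis_sub_neq_0.
  unfold Rdiv. rewrite Rmult_1_l. apply Rinv_le_contravar; [ lra | ].
  assert (H := Cmod_triangle (cis t - z) z).
  replace (cis t - z + z)%C with (cis t) in H by ring. rewrite Cmod_cis in H. lra.
Qed.

Lemma Cmod_cauchy_tail_le (f : R -> C) M z n :
  (forall t, continuous f t) -> (forall t, Cmod (f t) <= M) -> Cmod z < 1 ->
  Cmod (cauchy_tail f z n) <= M / (1 - Cmod z).
Proof.
  intros Hf HM Hz. apply Cmod_circle_mean_le; [ intros; cont | ].
  intros t. rewrite !Cmod_mult, Cmod_pow, Cmod_conj, Cmod_cis, pow1, Rmult_1_r.
  apply Rmult_le_compat; auto using Cmod_ge_0, Cmod_kernel_le.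
Qed.

Lemma pow_small q B eps : 0 <= q < 1 -> 0 < eps -> 0 <= B -> exists N, B * q ^ N < eps.
Proof.
  intros Hq He HB.
  destruct (pow_lt_1_zero q) with (y := eps / (B + 1)) as [N HN].
  - rewrite Rabs_pos_eq; lra.
  - apply Rdiv_lt_0_compat; lra.
  - exists N. specialize (HN N (Nat.le_refl _)).
    assert (0 <= q ^ N) by (apply pow_le; lra).
    rewrite Rabs_pos_eq in HN by auto. apply Rlt_div_r in HN; [ | lra ]. nra.
Qed.

(** For the constant function 1 all coefficients of positive index vanish, so its
    tail of index 1 equals z^n times a bounded quantity for every n. *)
Lemma circle_mean_cauchy_kernel z : Cmod z < 1 -> circle_mean (cauchy_kernel z) = RtoC 1.
Proof.
  intros Hz. set (one := fun _ : R => RtoC 1).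
  assert (H1 : forall t, continuous one t) by (intros; apply continuous_const).
  assert (Hc : forall n, circle_coef one (S n) = RtoC 0).
  { intros n. unfold circle_coef, one. rewrite <- (circle_mean_cis_conj_pow n).
    apply circle_mean_ext. intros; ring. }
  assert (Hb : forall n, Cmod (cauchy_tail one z n) <= 1 / (1 - Cmod z)).
  { intros n. apply Cmod_cauchy_tail_le; auto. intros; unfold one. rewrite Cmod_1. lra. }
  assert (Ht : forall n, cauchy_tail one z 1 = (z ^ n * cauchy_tail one z (S n))%C).
  { induction n as [|n IH].
    - simpl. ring.
    - rewrite IH, (cauchy_tail_S one z (S n)), Hc by auto. rewrite Cpow_S. ring. }
  assert (E : cauchy_tail one z 1 = RtoC 0).
  { apply Cmod_eq_0. apply Rle_antisym; [ | apply Cmod_ge_0 ].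
    apply le_epsilon. intros eps He.
    assert (0 < 1 / (1 - Cmod z)) by (apply Rdiv_lt_0_compat; lra).
    destruct (pow_small (Cmod z) (1 / (1 - Cmod z)) eps) as [N HN]; auto.
    - split; [ apply Cmod_ge_0 | auto ].
    - lra.
    - rewrite (Ht N), Cmod_mult, Cmod_pow. specialize (Hb (S N)).
      assert (0 <= Cmod z ^ N) by (apply pow_le, Cmod_ge_0). nra. }
  transitivity (cauchy_tail one z 0).
  - apply circle_mean_ext; intros; unfold one; simpl; ring.
  - rewrite cauchy_tail_S, E by auto. unfold circle_coef, one.
    rewrite (circle_mean_ext _ (fun _ => RtoC 1)) by (intros; simpl; ring).
    rewrite circle_mean_const. ring.
Qed.

Theorem cauchy_formula rho f f' z :
  1 < rho -> Cmod z < 1 -> holo rho f f' ->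
  circle_mean (fun t => (f (cis t) * cauchy_kernel z t)%C) = f z.
Proof.
  intros Hr Hz Hf. rewrite (cauchy_homotopy rho f f'), circle_mean_cauchy_kernel by auto. ring.
Qed.

Lemma circle_mean_value rho f f' :
  1 < rho -> holo rho f f' -> circle_mean (fun t => f (cis t)) = f (RtoC 0).
Proof.
  intros Hr Hf. rewrite <- (cauchy_formula rho f f' 0); auto.
  - apply circle_mean_ext. intros t. unfold cauchy_kernel.
    assert (cis t <> RtoC 0) by (intros E; generalize (Cmod_cis t); rewrite E, Cmod_0; lra).
    field. intros E. apply H. rewrite <- E. ring.
  - rewrite Cmod_0. lra.
Qed.

(** Mean value property of z^m f, which vanishes at 0. *)
Lemma negative_coef rho f f' m :
  1 < rho -> holo rho f f' -> f (RtoC 0) = RtoC 0 ->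
  circle_mean (fun t => (f (cis t) * cis t ^ m)%C) = RtoC 0.
Proof.
  intros Hr Hf H0.
  assert (Hm : exists g', holo rho (fun z => z ^ m * f z)%C g').
  { induction m as [|m [g' IH]].
    - exists f'. intros z Hz. destruct (Hf z Hz) as [H1 H2]. split; auto.
      intros eps He. destruct (H1 eps He) as [d [Hd H]]. exists d. split; auto.
      intros y Hy. simpl. rewrite !Cmult_1_l. auto.
    - eexists. intros z Hz.
      destruct (holo_mul_id _ _ _ IH z Hz) as [H1 H2]. split; [ | exact H2 ].
      intros eps He. destruct (H1 eps He) as [d [Hd H]]. exists d. split; auto.
      intros y Hy. rewrite !Cpow_S, <- !Cmult_assoc. auto. }
  destruct Hm as [g' Hg].
  transitivity (circle_mean (fun t => (fun z => z ^ m * f z)%C (cis t))).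
  - apply circle_mean_ext; intros; ring.
  - etransitivity; [ apply (circle_mean_value rho _ g' Hr Hg) | ].
    cbv beta. rewrite H0. ring.
Qed.

(** Dual form of the contractivity of multiplication by f/M on Hardy space.  For
    a trigonometric polynomial p = 1 + b w^(n+1), the pointwise bound
    Re (u f conj(w)^(n+2) p^2) <= M |p|^2 is integrated; the mean of
    f conj(w)^(n+2) p^2 is c_(n+2) + 2 b c_1, the last term b^2 f w^n having
    mean 0 by [negative_coef]. *)
Lemma circle_coef_bound rho f f' M n :
  1 < rho -> holo rho f f' -> f (RtoC 0) = RtoC 0 ->
  0 < M -> (forall t, Cmod (f (cis t)) <= M) ->
  Cmod (circle_coef (fun t => f (cis t)) (n + 2)) <=
  M - Cmod (circle_coef (fun t => f (cis t)) 1) ^ 2 / M.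
Proof.
  intros Hr Hf H0 HM Hb.
  set (F := fun t => f (cis t)).
  assert (HF : forall t, continuous F t).
  { intros t. apply (continuous_comp cis f).
    - apply continuous_cis, continuous_id.
    - apply (holo_continuous rho f f'); auto. rewrite Cmod_cis; lra. }
  set (c1 := circle_coef F 1). set (cn := circle_coef F (n + 2)).
  destruct (rotate_to_Cmod cn) as [u [Hu Eu]].
  (* This b minimizes M |b|^2 - 2 Re (u b c1), the part of the integrated bound
     that depends on b; the minimum is - |c1|^2 / M. *)
  set (b := (Cconj u * Cconj c1 / M)%C).
  assert (HMC : RtoC M <> RtoC 0) by (intros E; apply RtoC_inj in E; lra).
  assert (Huu : (u * Cconj u)%C = RtoC 1) by (rewrite <- Cmod2_conj, Hu; f_equal; ring).
  set (Y := fun t : R => (RtoC M * (1 + b * cis t ^ S n) * Cconj (1 + b * cis t ^ S n)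
      + - u * (F t * Cconj (cis t) ^ (n + 2)
               * ((1 + b * cis t ^ S n) * (1 + b * cis t ^ S n))))%C).
  assert (HY : forall t, 0 <= Re (Y t)).
  { intros t. unfold Y. set (p := (1 + b * cis t ^ S n)%C).
    assert (Q := Re_le_Cmod (u * (F t * Cconj (cis t) ^ (n + 2) * (p * p)))%C).
    rewrite !Cmod_mult, Cmod_pow, Cmod_conj, Cmod_cis, pow1, Hu in Q.
    specialize (Hb t). fold (F t) in Hb.
    replace (Re (RtoC M * p * Cconj p + - u * (F t * Cconj (cis t) ^ (n + 2) * (p * p)))%C)
      with (M * Cmod p ^ 2 - Re (u * (F t * Cconj (cis t) ^ (n + 2) * (p * p)))%C).
    - generalize (Cmod_ge_0 p); intros. nra.
    - replace (RtoC M * p * Cconj p)%C with (RtoC M * (p * Cconj p))%C by ring.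
      rewrite <- Cmod2_conj.
      generalize (F t * Cconj (cis t) ^ (n + 2) * (p * p))%C (Cmod p).
      intros q m. unfold Re; simpl. ring. }
  assert (EY : circle_mean Y = (RtoC M * (1 + b * Cconj b) + - u * (cn + 2 * b * c1))%C).
  { transitivity (circle_mean (fun t => ((RtoC M * (1 + b * Cconj b)) +
       (RtoC M * b * (cis t ^ S n) + (RtoC M * Cconj b * (Cconj (cis t) ^ S n) +
       (- u * (F t * Cconj (cis t) ^ (n + 2)) + (- u * (2 * b) * (F t * Cconj (cis t) ^ 1)
        + - u * (b * b) * (F t * cis t ^ n))))))%C)).
    - apply circle_mean_ext. intros t. unfold Y.
      rewrite Cplus_conj, Cmult_conj, Cpow_conj.
      replace (Cconj 1) with (RtoC 1) by (apply injective_projections; simpl; ring).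
      assert (W := cis_mul_conj t).
      set (w := cis t) in *. set (v := Cconj w) in *.
      assert (W1 : (w ^ S n * v ^ S n)%C = RtoC 1).
      { now rewrite <- Cpow_mult_l, W, Cpow_1_l. }
      rewrite (Nat.add_comm n 2). change (2 + n)%nat with (S (S n)).
      replace (RtoC M * (1 + b * w ^ S n) * (1 + Cconj b * v ^ S n))%C
        with (RtoC M * (1 + b * Cconj b * (w ^ S n * v ^ S n))
              + RtoC M * b * w ^ S n + RtoC M * Cconj b * v ^ S n)%C by ring.
      replace (F t * v ^ S (S n) * ((1 + b * w ^ S n) * (1 + b * w ^ S n)))%C
        with (F t * v ^ S (S n) + 2 * b * (F t * v * (w ^ S n * v ^ S n))
              + b * b * (F t * w ^ n * (w * v) * (w ^ S n * v ^ S n)))%C.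
      + rewrite W1, W. simpl. ring.
      + simpl. ring.
    - assert (E1 := circle_mean_cis_pow n). assert (E2 := circle_mean_cis_conj_pow n).
      assert (E3 := negative_coef rho f f' n Hr Hf H0).
      rewrite !circle_mean_plus by (intros; cont).
      rewrite circle_mean_const.
      rewrite (circle_mean_scal (RtoC M * b) (fun t => cis t ^ S n)%C) by (intros; cont).
      rewrite (circle_mean_scal (RtoC M * Cconj b) (fun t => Cconj (cis t) ^ S n)%C) by (intros; cont).
      rewrite (circle_mean_scal (- u) (fun t => F t * Cconj (cis t) ^ (n + 2))%C) by (intros; cont).
      rewrite (circle_mean_scal (- u * (2 * b)) (fun t => F t * Cconj (cis t) ^ 1)%C) by (intros; cont).
      rewrite (circle_mean_scal (- u * (b * b)) (fun t => F t * cis t ^ n)%C) by (intros; cont).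
      unfold F in *. rewrite E1, E2, E3.
      change (circle_mean (fun t => f (cis t) * Cconj (cis t) ^ (n + 2))%C) with cn.
      change (circle_mean (fun t => f (cis t) * Cconj (cis t) ^ 1)%C) with c1. ring. }
  assert (P : 0 <= Re (circle_mean Y)).
  { apply circle_mean_Re_ge0; auto. intros t. unfold Y. cont. }
  rewrite EY in P.
  replace (RtoC M * (1 + b * Cconj b) + - u * (cn + 2 * b * c1))%C
    with (RtoC (M - Cmod cn - Cmod c1 ^ 2 / M)) in P.
  - simpl in P. simpl. lra.
  - rewrite !RtoC_minus, RtoC_div by lra.
    rewrite RtoC_pow.
    replace (RtoC M * (1 + b * Cconj b) + - u * (cn + 2 * b * c1))%C
      with (RtoC M * (1 + b * Cconj b) - u * cn - 2 * (u * b) * c1)%C by ring.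
    assert (Ec : (c1 * Cconj c1)%C = (Cmod c1 ^ 2)%C) by (rewrite <- Cmod2_conj, RtoC_pow; auto).
    replace (b * Cconj b)%C with ((u * Cconj u) * (c1 * Cconj c1) / (M * M))%C.
    + rewrite Eu, Huu, Ec. unfold b.
      replace (u * (Cconj u * Cconj c1 / M))%C with ((u * Cconj u) * Cconj c1 / M)%C by (field; auto).
      rewrite Huu.
      replace (2 * (1 * Cconj c1 / M) * c1)%C with (2 * (c1 * Cconj c1) / M)%C by (field; auto).
      rewrite Ec. field; auto.
    + unfold b. rewrite Cdiv_conj, Cmult_conj, !Cconj_conj by auto.
      replace (Cconj M) with (RtoC M) by (apply injective_projections; simpl; ring).
      field; auto.
Qed.

(** * Bounds for a bounded analytic function with h(0) = 0 *)

Lemma continuous_circle rho f f' :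
  1 < rho -> holo rho f f' -> forall t : R, continuous (fun t => f (cis t)) t.
Proof.
  intros Hr Hf t. apply (continuous_comp cis f).
  - apply (continuous_cis (fun t => t)), continuous_id.
  - apply (holo_continuous rho f f'); auto. rewrite Cmod_cis; lra.
Qed.

Lemma taylor_2 rho f f' z :
  1 < rho -> Cmod z < 1 -> holo rho f f' -> f (RtoC 0) = RtoC 0 ->
  f z = (z * circle_coef (fun t => f (cis t)) 1 + z ^ 2 * cauchy_tail (fun t => f (cis t)) z 2)%C.
Proof.
  intros Hr Hz Hf H0. assert (Hc := continuous_circle rho f f' Hr Hf).
  assert (E : f z = cauchy_tail (fun t => f (cis t)) z 0).
  { rewrite <- (cauchy_formula rho f f' z) by auto. apply circle_mean_ext; intros; simpl; ring. }
  rewrite E, (cauchy_tail_S _ z 0), (cauchy_tail_S _ z 1) by auto.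
  replace (circle_coef (fun t => f (cis t)) 0) with (RtoC 0).
  - simpl. ring.
  - rewrite <- H0, <- (circle_mean_value rho f f' Hr Hf). apply circle_mean_ext; intros; simpl; ring.
Qed.

(** The second-order expansion shows that [circle_coef _ 1] is a derivative at 0,
    and derivatives are unique. *)
Lemma circle_coef_1 rho f f' M :
  1 < rho -> holo rho f f' -> f (RtoC 0) = RtoC 0 ->
  (forall t, Cmod (f (cis t)) <= M) ->
  circle_coef (fun t => f (cis t)) 1 = f' (RtoC 0).
Proof.
  intros Hr Hf H0 HM.
  assert (HM0 : 0 <= M) by (apply Rle_trans with (2 := HM 0), Cmod_ge_0).
  apply (Cdiff_unique f (RtoC 0)); [ | apply Hf; rewrite Cmod_0; lra ].
  intros eps He.
  assert (Hm : 0 < Rmin (1 / 2) (eps / (2 * M + 1))).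
  { apply Rmin_pos; [ lra | ]. apply Rdiv_lt_0_compat; lra. }
  exists (Rmin (1 / 2) (eps / (2 * M + 1))). split; auto. intros y Hy.
  rewrite H0. replace (y - 0)%C with y in * by ring.
  assert (Y1 := Rlt_le_trans _ _ _ Hy (Rmin_l _ _)).
  assert (Y2 := Rlt_le_trans _ _ _ Hy (Rmin_r _ _)).
  apply Rlt_div_r in Y2; [ | lra ].
  assert (Hy1 : Cmod y < 1) by lra.
  assert (T := Cmod_cauchy_tail_le _ M y 2 (continuous_circle rho f f' Hr Hf) HM Hy1).
  rewrite (taylor_2 rho f f' y) by auto.
  replace (y * circle_coef (fun t => f (cis t)) 1 + y ^ 2 * cauchy_tail (fun t => f (cis t)) y 2 - 0
           - y * circle_coef (fun t => f (cis t)) 1)%C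
    with (y * y * cauchy_tail (fun t => f (cis t)) y 2)%C by (simpl; ring).
  rewrite !Cmod_mult.
  assert (T2 : M / (1 - Cmod y) <= 2 * M).
  { apply Rle_div_l; [ lra | nra ]. }
  generalize (Cmod_ge_0 y) (Cmod_ge_0 (cauchy_tail (fun t => f (cis t)) y 2)). intros.
  rewrite Rmult_assoc, (Rmult_comm eps). apply Rmult_le_compat_l; auto.
  apply Rle_trans with (Cmod y * (2 * M)); [ | nra ].
  apply Rmult_le_compat_l; auto. exact (Rle_trans _ _ _ T T2).
Qed.

(** The functional al f(z) - be f(w), applied to the part of f of order at least 2,
    equals the sum of c_n (al z^n - be w^n).  The sequence X of tails carries
    this expansion without infinite sums: X_n - X_(n+1) is its n-th term and
    X_n tends to 0 geometrically. *)
Lemma two_point_bound_larger_disk rho f f' M z w al be S :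
  1 < rho -> holo rho f f' -> f (RtoC 0) = RtoC 0 ->
  0 < M -> (forall t, Cmod (f (cis t)) <= M) ->
  Cmod z < 1 -> Cmod w < 1 ->
  (forall N, sum_f_R0 (fun k => Cmod (al * z ^ (k + 2) - be * w ^ (k + 2))) N <= S) ->
  Cmod (al * (f z - z * f' 0) - be * (f w - w * f' 0)) <=
  (M - Cmod (f' (RtoC 0)) ^ 2 / M) * S.
Proof.
  intros Hr Hf H0 HM Hb Hz Hw HS.
  assert (Hc := continuous_circle rho f f' Hr Hf).
  assert (Hk := fun n => circle_coef_bound rho f f' M n Hr Hf H0 HM Hb).
  rewrite (circle_coef_1 rho f f' M) in Hk by auto.
  set (K := M - Cmod (f' (RtoC 0)) ^ 2 / M) in *.
  assert (HK : 0 <= K) by (apply Rle_trans with (2 := Hk 0%nat), Cmod_ge_0).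
  set (F := fun t => f (cis t)) in *.
  set (X := fun n => (al * z ^ n * cauchy_tail F z n - be * w ^ n * cauchy_tail F w n)%C).
  assert (X2 : (al * (f z - z * f' 0) - be * (f w - w * f' 0))%C = X 2%nat).
  { unfold X. rewrite (taylor_2 rho f f' z), (taylor_2 rho f f' w) by auto.
    rewrite (circle_coef_1 rho f f' M) by auto. fold F. ring. }
  assert (XS : forall n, X n = (circle_coef F n * (al * z ^ n - be * w ^ n) + X (Datatypes.S n))%C).
  { intros n. unfold X. rewrite (cauchy_tail_S F z n), (cauchy_tail_S F w n), !Cpow_S by auto. ring. }
  assert (XN : forall N, Cmod (X 2%nat) <=
     K * sum_f_R0 (fun k => Cmod (al * z ^ (k + 2) - be * w ^ (k + 2))) N + Cmod (X (N + 3)%nat)).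
  { assert (St : forall n, Cmod (X (n + 2)%nat) <=
       K * Cmod (al * z ^ (n + 2) - be * w ^ (n + 2)) + Cmod (X (n + 3)%nat)).
    { intros n. rewrite XS. eapply Rle_trans; [ apply Cmod_triangle | ].
      rewrite Cmod_mult. replace (Datatypes.S (n + 2)) with (n + 3)%nat by lia.
      apply Rplus_le_compat_r, Rmult_le_compat_r; [ apply Cmod_ge_0 | apply Hk ]. }
    induction N as [|N IH].
    - exact (St 0%nat).
    - eapply Rle_trans; [ exact IH | ]. rewrite tech5, Rmult_plus_distr_l.
      specialize (St (Datatypes.S N)).
      replace (Datatypes.S N + 2)%nat with (N + 3)%nat in * by lia. lra. }
  rewrite X2. apply le_epsilon. intros eps He.
  set (q := Rmax (Cmod z) (Cmod w)).
  assert (Hq : 0 <= q < 1).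
  { split; [ eapply Rle_trans, Rmax_l; apply Cmod_ge_0 | now apply Rmax_lub_lt ]. }
  set (B := Cmod al * (M / (1 - Cmod z)) + Cmod be * (M / (1 - Cmod w))).
  assert (P1 : 0 < M / (1 - Cmod z)) by (apply Rdiv_lt_0_compat; lra).
  assert (P2 : 0 < M / (1 - Cmod w)) by (apply Rdiv_lt_0_compat; lra).
  assert (A1 := Cmod_ge_0 al). assert (A2 := Cmod_ge_0 be).
  assert (HB : 0 <= B) by (unfold B; nra).
  destruct (pow_small q B eps Hq He HB) as [N HN].
  eapply Rle_trans; [ apply (XN N) | ].
  apply Rplus_le_compat; [ now apply Rmult_le_compat_l | ].
  apply Rlt_le, Rle_lt_trans with (2 := HN).
  assert (Hpow : forall x : C, Cmod x <= q -> Cmod x ^ (N + 3) <= q ^ N).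
  { intros x Hx. apply Rle_trans with (q ^ (N + 3)).
    - apply pow_incr; split; [ apply Cmod_ge_0 | auto ].
    - rewrite pow_add. rewrite <- (Rmult_1_r (q ^ N)) at 2.
      apply Rmult_le_compat_l; [ apply pow_le; lra | ].
      rewrite <- (pow1 3). apply pow_incr; lra. }
  unfold X, Cminus. eapply Rle_trans; [ apply Cmod_triangle | ].
  rewrite Cmod_opp, !Cmod_mult, !Cmod_pow. unfold B. rewrite Rmult_plus_distr_r.
  assert (Tz := Cmod_cauchy_tail_le F M z (N + 3) Hc Hb Hz).
  assert (Tw := Cmod_cauchy_tail_le F M w (N + 3) Hc Hb Hw).
  assert (Qz := Hpow z (Rmax_l _ _)). assert (Qw := Hpow w (Rmax_r _ _)).
  apply Rplus_le_compat.
  - rewrite !Rmult_assoc. apply Rmult_le_compat_l; auto.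
    rewrite (Rmult_comm (M / _)). apply Rmult_le_compat; auto using Cmod_ge_0.
    apply pow_le, Cmod_ge_0.
  - rewrite !Rmult_assoc. apply Rmult_le_compat_l; auto.
    rewrite (Rmult_comm (M / _)). apply Rmult_le_compat; auto using Cmod_ge_0.
    apply pow_le, Cmod_ge_0.
Qed.

Lemma continuous_Cmod {U : UniformSpace} (f : U -> C) (x : U) :
  continuous f x -> continuous (fun u => Cmod (f u)) x.
Proof.
  intros Hf.
  apply (continuous_ext (fun u => @norm R_AbsRing (prod_NormedModule _ R_NormedModule R_NormedModule) (f u))).
  { intros u. symmetry. apply Cmod_norm. }
  apply (continuous_comp f (fun c => @norm R_AbsRing (prod_NormedModule _ R_NormedModule R_NormedModule) c)).
  - exact Hf.
  - apply (filterlim_norm (V := prod_NormedModule _ R_NormedModule R_NormedModule)).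
Qed.

(** Passage to the limit r -> 1 from below in an inequality. *)
Lemma continuous_le_left (P Q : R -> R) :
  continuous P 1 -> continuous Q 1 ->
  (forall r, 0 < r < 1 -> P r <= Q r) -> P 1 <= Q 1.
Proof.
  intros HP HQ H. apply Rnot_lt_le. intros Hlt.
  assert (HD : continuous (fun r => P r - Q r) 1) by now apply (continuous_minus P Q).
  assert (Hpos : 0 < P 1 - Q 1) by lra.
  destruct (HD (fun x => 0 < x)) as [d Hd].
  { exists (mkposreal _ Hpos). intros y Hy.
    unfold ball in Hy; simpl in Hy; unfold AbsRing_ball, abs, minus, plus, opp in Hy; simpl in Hy.
    apply Rabs_def2 in Hy. lra. }
  set (r := 1 - Rmin d 1 / 2).
  assert (Hm : 0 < Rmin d 1) by (apply Rmin_pos; [ apply cond_pos | lra ]).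
  assert (M1 := Rmin_l d 1). assert (M2 := Rmin_r d 1).
  assert (Hr : 0 < P r - Q r).
  { apply Hd. unfold ball; simpl; unfold AbsRing_ball, abs, minus, plus, opp; simpl.
    unfold r. apply Rabs_def1; lra. }
  specialize (H r). unfold r in *. lra.
Qed.

Lemma holo_dilation h h' r :
  0 < r < 1 -> holo 1 h h' -> holo (/ r) (fun z => h (r * z)%C) (fun z => r * h' (r * z))%C.
Proof.
  intros Hr Hh z Hz.
  assert (Hz' : Cmod (r * z) < 1).
  { rewrite Cmod_mult, Cmod_R, Rabs_pos_eq by lra.
    apply Rmult_lt_compat_l with (r := r) in Hz; [ | lra ].
    rewrite Rinv_r in Hz; lra. }
  destruct (Hh _ Hz') as [H1 H2]. split.
  - apply Cdiff_dilation; [ lra | auto ].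
  - apply continuous_Cmult; [ apply continuous_const | ].
    apply (continuous_comp (fun z => r * z)%C h'); auto.
    apply continuous_Cmult; [ apply continuous_const | apply continuous_id ].
Qed.

(** Apply the previous bound to the dilations h(r z), which are analytic beyond the
    closed unit disk, and let r tend to 1. *)
Theorem two_point_bound h h' M z w al be S :
  holo 1 h h' -> h (RtoC 0) = RtoC 0 ->
  0 < M -> (forall z, Cmod z < 1 -> Cmod (h z) <= M) ->
  Cmod z < 1 -> Cmod w < 1 ->
  (forall N, sum_f_R0 (fun k => Cmod (al * z ^ (k + 2) - be * w ^ (k + 2))) N <= S) ->
  Cmod (al * (h z - z * h' 0) - be * (h w - w * h' 0)) <=
  (M - Cmod (h' (RtoC 0)) ^ 2 / M) * S.
Proof.
  intros Hh H0 HM Hb Hz Hw HS.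
  assert (Hray : forall v, Cmod v < 1 -> continuous (fun r : R => h (r * v)%C) 1).
  { intros v Hv. apply (continuous_comp (fun r : R => r * v)%C h).
    - apply continuous_Cmult; [ | apply continuous_const ].
      apply continuous_Cpair; [ apply continuous_id | apply continuous_const ].
    - rewrite Cmult_1_l. now apply (holo_continuous 1 h h'). }
  assert (Hid : continuous (fun r : R => RtoC r) 1).
  { apply continuous_Cpair; [ apply continuous_id | apply continuous_const ]. }
  assert (L := continuous_le_left
    (fun r => Cmod (al * (h (r * z) - z * (r * h' 0)) - be * (h (r * w) - w * (r * h' 0)))%C)
    (fun r : R => (M - Cmod (r * h' (RtoC 0)) ^ 2 / M) * S)).
  cbv beta in L. rewrite !Cmult_1_l in L. apply L; clear L.
  - apply continuous_Cmod. unfold Cminus.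
    apply continuous_Cplus; [ | apply continuous_Copp ];
    (apply continuous_Cmult; [ apply continuous_const | ]);
    (apply continuous_Cplus; [ now apply Hray | apply continuous_Copp ]);
    (apply continuous_Cmult; [ apply continuous_const | ]);
    (apply continuous_Cmult; [ exact Hid | apply continuous_const ]).
  - apply (continuous_ext (fun r : R => (M + - / M * (Cmod (r * h' (RtoC 0)) * Cmod (r * h' (RtoC 0)))) * S)
      (fun r : R => (M - Cmod (r * h' (RtoC 0)) ^ 2 / M) * S)).
    { intros r. cbv beta. match goal with |- ?a = ?b => change (@eq R a b) end. field. lra. }
    assert (HC : continuous (fun r : R => Cmod (r * h' (RtoC 0))) 1).
    { apply continuous_Cmod, continuous_Cmult; [ exact Hid | apply continuous_const ]. }
    apply (continuous_mult (K := R_AbsRing)); [ | apply continuous_const ].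
    apply (continuous_plus (V := R_NormedModule)); [ apply continuous_const | ].
    apply (continuous_mult (K := R_AbsRing)); [ apply continuous_const | ].
    apply (continuous_mult (K := R_AbsRing)); exact HC.
  - intros r Hr.
    assert (Hd := holo_dilation h h' r Hr Hh).
    assert (Hr1 : 1 < / r) by (rewrite <- Rinv_1; apply Rinv_lt_contravar; lra).
    assert (Hr0 : (r * 0)%C = RtoC 0) by ring.
    assert (B := two_point_bound_larger_disk (/ r) _ _ M z w al be S Hr1 Hd).
    cbv beta in B. rewrite Hr0 in B. apply B; auto.
    intros t. apply Hb. rewrite Cmod_mult, Cmod_cis, Cmod_R, Rabs_pos_eq; lra.
Qed.

(** * From the harmonic function to its analytic parts *)

Lemma analytic_on_Cdiff D f z :
  analytic_on D f -> D z -> Cdiff f z (C_derive f z).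
Proof. intros H Hz. apply is_derive_Cdiff, (C_derive_correct f z z), H, Hz. Qed.

Lemma disk_near z : disk 1 z -> exists d : posreal, forall y, Cmod (y - z) < d -> disk 1 y.
Proof.
  unfold disk. intros Hz. assert (H : 0 < 1 - Cmod z) by lra.
  exists (mkposreal _ H). simpl. intros y Hy.
  replace y with ((y - z) + z)%C by ring.
  eapply Rle_lt_trans; [ apply Cmod_triangle | lra ].
Qed.

(** Used with horizontal and vertical lines p; the isometry condition keeps p near
    p t inside the disk, where g splits. *)
Lemma derive_along_path (g g1 g2 : C -> C)
  (Hg : forall z, disk 1 z -> g z = (g1 z + Cconj (g2 z))%C) 
  (p : R -> C) (v : C) t l1 l2 :
  disk 1 (p t) -> is_path_derive p t v ->
  (forall s, Cmod (p s - p t) = Rabs (s - t)) ->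
  Cdiff g1 (p t) l1 -> Cdiff g2 (p t) l2 ->
  is_path_derive (fun s => g (p s)) t (v * l1 + Cconj (v * l2))%C.
Proof.
  intros Hz Hp Hdist H1 H2.
  assert (L : locally t (fun s => (g1 (p s) + Cconj (g2 (p s)))%C = g (p s))).
  { destruct (disk_near _ Hz) as [d Hd]. exists d. intros s Hs. symmetry. apply Hg, Hd.
    rewrite Hdist. exact Hs. }
  destruct (is_path_derive_comp g1 p t v l1 Hp H1) as [R1 I1].
  destruct (is_path_derive_comp g2 p t v l2 Hp H2) as [R2 I2].
  split.
  - apply (is_derive_ext_loc (fun s => Re (g1 (p s)) + Re (g2 (p s)))).
    + apply (filter_imp _ _ (fun s Hs => f_equal Re Hs) L).
    + apply (is_derive_plus (fun s => Re (g1 (p s))) (fun s => Re (g2 (p s))) t _ _ R1 R2).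
  - apply (is_derive_ext_loc (fun s => Im (g1 (p s)) + - Im (g2 (p s)))).
    + apply (filter_imp _ _ (fun s Hs => f_equal Im Hs) L).
    + apply (is_derive_plus (fun s => Im (g1 (p s))) (fun s => - Im (g2 (p s))) t _ _ I1).
      apply (is_derive_opp (fun s => Im (g2 (p s))) t _ I2).
Qed.

Lemma d_x_analytic (g g1 g2 : C -> C)
  (Hg : forall z, disk 1 z -> g z = (g1 z + Cconj (g2 z))%C) z l1 l2 :
  disk 1 z -> Cdiff g1 z l1 -> Cdiff g2 z l2 -> d_x g z = (l1 + Cconj l2)%C.
Proof.
  intros Hz H1 H2.
  destruct (derive_along_path g g1 g2 Hg (fun t => (t, Im z)) (RtoC 1) (Re z) l1 l2) as [D1 D2].
  - now destruct z.
  - split; simpl.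
    + auto_derive; [ exact I | ring ].
    + auto_derive; [ exact I | ring ].
  - intros s. replace ((s, Im z) - (Re z, Im z))%C with (RtoC (s - Re z))
      by (apply injective_projections; simpl; ring). apply Cmod_R.
  - now destruct z.
  - now destruct z.
  - unfold d_x. apply injective_projections; cbn [fst snd].
    + etransitivity; [ exact (is_derive_unique _ _ _ D1) | ]. now rewrite !Cmult_1_l.
    + etransitivity; [ exact (is_derive_unique _ _ _ D2) | ]. now rewrite !Cmult_1_l.
Qed.

Lemma d_y_analytic (g g1 g2 : C -> C)
  (Hg : forall z, disk 1 z -> g z = (g1 z + Cconj (g2 z))%C) z l1 l2 :
  disk 1 z -> Cdiff g1 z l1 -> Cdiff g2 z l2 -> d_y g z = (Ci * (l1 - Cconj l2))%C.
Proof.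
  intros Hz H1 H2.
  destruct (derive_along_path g g1 g2 Hg (fun t => (Re z, t)) Ci (Im z) l1 l2) as [D1 D2].
  - now destruct z.
  - split; simpl.
    + auto_derive; [ exact I | ring ].
    + auto_derive; [ exact I | ring ].
  - intros s. replace ((Re z, s) - (Re z, Im z))%C with (Ci * RtoC (s - Im z))%C
      by (apply injective_projections; simpl; ring).
    rewrite Cmod_mult, Cmod_Ci, Rmult_1_l. apply Cmod_R.
  - now destruct z.
  - now destruct z.
  - unfold d_y. apply injective_projections; cbn [fst snd].
    + etransitivity; [ exact (is_derive_unique _ _ _ D1) | ].
      destruct l1, l2; unfold Re; simpl; ring.
    + etransitivity; [ exact (is_derive_unique _ _ _ D2) | ].
      destruct l1, l2; unfold Im; simpl; ring.
Qed.

Lemma d_z_analytic (g g1 g2 : C -> C)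
  (Hg : forall z, disk 1 z -> g z = (g1 z + Cconj (g2 z))%C) z l1 l2 :
  disk 1 z -> Cdiff g1 z l1 -> Cdiff g2 z l2 -> d_z g z = l1.
Proof.
  intros Hz H1 H2. unfold d_z. rewrite (d_x_analytic g g1 g2 Hg z l1 l2), (d_y_analytic g g1 g2 Hg z l1 l2) by auto.
  destruct l1, l2. apply injective_projections; simpl; field.
Qed.

Lemma d_zbar_analytic (g g1 g2 : C -> C)
  (Hg : forall z, disk 1 z -> g z = (g1 z + Cconj (g2 z))%C) z l1 l2 :
  disk 1 z -> Cdiff g1 z l1 -> Cdiff g2 z l2 -> d_zbar g z = Cconj l2.
Proof.
  intros Hz H1 H2. unfold d_zbar. rewrite (d_x_analytic g g1 g2 Hg z l1 l2), (d_y_analytic g g1 g2 Hg z l1 l2) by auto.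
  destruct l1, l2. apply injective_projections; simpl; field.
Qed.

Lemma harmonic_continuous_partials g z :
  harmonic_on (disk 1) g -> disk 1 z -> continuous (d_x g) z /\ continuous (d_y g) z.
Proof.
  intros [HR HI] Hz. destruct z as [x y].
  destruct (HR x y Hz) as [[_ [_ [_ [[R1 _] [R2 _]]]]] _].
  destruct (HI x y Hz) as [[_ [_ [_ [[I1 _] [I2 _]]]]] _].
  apply continuity_2d_pt_filterlim in R1, R2, I1, I2.
  split; apply continuous_Cpair; assumption.
Qed.

(** Complex differentiability alone gives no continuity of the derivative without
    Goursat's theorem; here it comes from the continuous first partials of g. *)
Lemma harmonic_parts_holo g g1 g2 :
  harmonic_on (disk 1) g -> analytic_on (disk 1) g1 -> analytic_on (disk 1) g2 ->
  (forall z, disk 1 z -> g z = (g1 z + Cconj (g2 z))%C) ->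
  holo 1 g1 (d_z g) /\ holo 1 g2 (fun z => Cconj (d_zbar g z)).
Proof.
  intros Hh H1 H2 Hg.
  assert (Ha := fun z Hz => analytic_on_Cdiff _ g1 z H1 Hz).
  assert (Hb := fun z Hz => analytic_on_Cdiff _ g2 z H2 Hz).
  split; intros z Hz; destruct (harmonic_continuous_partials g z Hh Hz) as [Cx Cy]; split.
  - rewrite (d_z_analytic g g1 g2 Hg z _ _ Hz (Ha z Hz) (Hb z Hz)). auto.
  - unfold d_z. apply continuous_Cmult; [ apply continuous_const | ].
    apply continuous_Cplus; [ exact Cx | ]. apply continuous_Copp.
    apply continuous_Cmult; [ apply continuous_const | exact Cy ].
  - rewrite (d_zbar_analytic g g1 g2 Hg z _ _ Hz (Ha z Hz) (Hb z Hz)), Cconj_conj. auto.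
  - apply continuous_Cconj. unfold d_zbar. apply continuous_Cmult; [ apply continuous_const | ].
    apply continuous_Cplus; [ exact Cx | ].
    apply continuous_Cmult; [ apply continuous_const | exact Cy ].
Qed.

Lemma align_pair (x y : C) : exists u : C, Cmod u = 1 /\ Cmod (x + u * y) = Cmod x + Cmod y.
Proof.
  destruct (rotate_to_Cmod x) as [v [Hv Ev]]. destruct (rotate_to_Cmod y) as [v' [Hv' Ev']].
  exists (Cconj v * v')%C. split.
  - rewrite Cmod_mult, Cmod_conj, Hv, Hv'. ring.
  - assert (W : (v * Cconj v)%C = RtoC 1) by (rewrite <- Cmod2_conj, Hv; f_equal; ring).
    transitivity (Cmod (v * (x + Cconj v * v' * y))).
    { rewrite Cmod_mult, Hv. ring. }
    replace (v * (x + Cconj v * v' * y))%C with (v * x + (v * Cconj v) * (v' * y))%C by ring.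
    rewrite W, Ev, Ev', Cmult_1_l, <- RtoC_plus, Cmod_R. apply Rabs_pos_eq.
    generalize (Cmod_ge_0 x) (Cmod_ge_0 y); lra.
Qed.

Lemma holo_combination u g1 g2 g1' g2' :
  holo 1 g1 g1' -> holo 1 g2 g2' ->
  holo 1 (fun z => g1 z + u * g2 z)%C (fun z => g1' z + u * g2' z)%C.
Proof.
  intros H1 H2 z Hz. destruct (H1 z Hz) as [D1 C1]. destruct (holo_scal 1 u g2 g2' H2 z Hz) as [D2 C2].
  split.
  - apply (Cdiff_plus g1 (fun z => u * g2 z)%C); auto.
  - now apply continuous_Cplus.
Qed.

(** For c = f'(0) and f(0) = 0, the part of f of order at least 2. *)
Definition remainder (f : C -> C) (c z : C) : C := (f z - z * c)%C.

Lemma geometric_sum_le r N : 0 <= r < 1 -> sum_f_R0 (fun k => r ^ (k + 2)) N <= r ^ 2 / (1 - r).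
Proof.
  intros Hr.
  assert (E : sum_f_R0 (fun k => r ^ (k + 2)) N = r ^ 2 / (1 - r) - r ^ (N + 3) / (1 - r)).
  { induction N as [|N IH].
    - simpl. field. lra.
    - rewrite tech5, IH. replace (S N + 2)%nat with (N + 3)%nat by lia.
      replace (S N + 3)%nat with (S (N + 3)) by lia. simpl. field. lra. }
  rewrite E. assert (0 <= r ^ (N + 3) / (1 - r)).
  { apply Rle_mult_inv_pos; [ apply pow_le |]; lra. }
  lra.
Qed.

Lemma derived_geometric_sum_le r N :
  0 <= r < 1 -> sum_f_R0 (fun k => INR (k + 2) * r ^ (k + 1)) N <= / (1 - r) ^ 2 - 1.
Proof.
  intros Hr.
  (* The subtracted fraction is the derivative of r^m / (1 - r) at m = N + 3, the tail
     of the series. *)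
  assert (E : sum_f_R0 (fun k => INR (k + 2) * r ^ (k + 1)) N =
     / (1 - r) ^ 2 - 1 - r ^ (N + 2) * (INR (N + 3) - INR (N + 2) * r) / (1 - r) ^ 2).
  { induction N as [|N IH].
    - simpl. field. lra.
    - rewrite tech5, IH. replace (S N + 2)%nat with (N + 3)%nat by lia.
      replace (S N + 1)%nat with (N + 2)%nat by lia.
      replace (S N + 3)%nat with (S (N + 3)) by lia.
      replace (N + 3)%nat with (S (N + 2)) by lia. rewrite !S_INR. simpl. field. lra. }
  rewrite E.
  assert (0 <= r ^ (N + 2) * (INR (N + 3) - INR (N + 2) * r) / (1 - r) ^ 2).
  { apply Rle_mult_inv_pos; [ | apply pow_lt; lra ].
    apply Rmult_le_pos; [ apply pow_le; lra | ].
    replace (N + 3)%nat with (S (N + 2)) by lia. rewrite S_INR.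
    generalize (pos_INR (N + 2)). nra. }
  lra.
Qed.

Definition bounded_pair (M : R) (g1 g2 g1' g2' : C -> C) : Prop :=
  holo 1 g1 g1' /\ holo 1 g2 g2' /\
  g1 (RtoC 0) = RtoC 0 /\ g2 (RtoC 0) = RtoC 0 /\
  forall z, Cmod z < 1 -> Cmod (g1 z) + Cmod (g2 z) <= M.

Lemma combination_bound M g1 g2 g1' g2' u z w al be S M' :
  bounded_pair M g1 g2 g1' g2' ->
  0 < M' -> M <= M' -> Cmod u = 1 -> Cmod z < 1 -> Cmod w < 1 ->
  (forall N, sum_f_R0 (fun k => Cmod (al * z ^ (k + 2) - be * w ^ (k + 2))) N <= S) ->
  Cmod ((al * remainder g1 (g1' 0) z - be * remainder g1 (g1' 0) w)
        + u * (al * remainder g2 (g2' 0) z - be * remainder g2 (g2' 0) w)) <=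
  (M' - Cmod (g1' 0 + u * g2' 0) ^ 2 / M') * S.
Proof.
  intros (H1 & H2 & E1 & E2 & HM) HM' HMM Hu Hz Hw HS.
  assert (B := two_point_bound _ _ M' z w al be S (holo_combination u g1 g2 g1' g2' H1 H2)).
  cbv beta in B. set (a := g1' (RtoC 0)) in *. set (b := g2' (RtoC 0)) in *.
  replace (al * remainder g1 a z - be * remainder g1 a w
           + u * (al * remainder g2 b z - be * remainder g2 b w))%C
    with (al * (g1 z + u * g2 z - z * (a + u * b)) - be * (g1 w + u * g2 w - w * (a + u * b)))%C
    by (unfold remainder; ring).
  apply B; auto.
  - rewrite E1, E2. ring.
  - intros v Hv. eapply Rle_trans; [ apply Cmod_triangle | ].
    rewrite Cmod_mult, Hu, Rmult_1_l. eapply Rle_trans; [ apply HM | ]; auto.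
Qed.

(** With al = be = 0 and S = 1, [combination_bound] says that M' - |h'(0)|^2 / M'
    is nonnegative; M' = M + eps is positive even when M = 0. *)
Lemma sum_derivatives_le M g1 g2 g1' g2' :
  bounded_pair M g1 g2 g1' g2' ->
  Cmod (g1' (RtoC 0)) + Cmod (g2' (RtoC 0)) <= M.
Proof.
  intros HP. assert (HM := proj2 (proj2 (proj2 (proj2 HP)))).
  set (a := g1' (RtoC 0)). set (b := g2' (RtoC 0)).
  assert (M0 : 0 <= M).
  { apply Rle_trans with (2 := HM 0 ltac:(rewrite Cmod_0; lra)).
    generalize (Cmod_ge_0 (g1 0)) (Cmod_ge_0 (g2 0)); lra. }
  apply le_epsilon. intros eps He.
  destruct (align_pair a b) as [u [Hu Eu]].
  assert (B := combination_bound M g1 g2 g1' g2' u (RtoC 0) (RtoC 0) (RtoC 0) (RtoC 0) 1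
                 (M + eps) HP).
  fold a b in B. rewrite Eu in B.
  assert (P : 0 <= (M + eps - (Cmod a + Cmod b) ^ 2 / (M + eps)) * 1).
  { eapply Rle_trans; [ apply Cmod_ge_0 | apply B; auto; try lra; try (rewrite Cmod_0; lra) ].
    intros N. replace (sum_f_R0 _ N) with 0; [ lra | ].
    symmetry. apply sum_eq_R0. intros n _.
    replace (0 * 0 ^ (n + 2) - 0 * 0 ^ (n + 2))%C with (RtoC 0) by ring. apply Cmod_0. }
  rewrite Rmult_1_r in P.
  assert (Q : (Cmod a + Cmod b) ^ 2 <= (M + eps) ^ 2).
  { apply Rle_minus_r in P. rewrite Rplus_0_l in P. apply Rle_div_l in P; nra. }
  generalize (Cmod_ge_0 a) (Cmod_ge_0 b). nra.
Qed.

(** For the aligning u one has |a + u b| >= |a| - |b| >= l, so the coefficient bound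
    of g1 + u g2 is at most M - l^2 / M, whatever u is. *)
Lemma pair_bound M g1 g2 g1' g2' l z w al be S :
  bounded_pair M g1 g2 g1' g2' ->
  0 < M -> 0 <= l <= Cmod (g1' (RtoC 0)) - Cmod (g2' (RtoC 0)) -> Cmod z < 1 -> Cmod w < 1 ->
  (forall N, sum_f_R0 (fun k => Cmod (al * z ^ (k + 2) - be * w ^ (k + 2))) N <= S) ->
  Cmod (al * remainder g1 (g1' 0) z - be * remainder g1 (g1' 0) w)
  + Cmod (al * remainder g2 (g2' 0) z - be * remainder g2 (g2' 0) w) <=
  (M - l ^ 2 / M) * S.
Proof.
  intros HP M_pos Hl Hz Hw HS.
  set (a := g1' (RtoC 0)) in *. set (b := g2' (RtoC 0)) in *.
  destruct (align_pair (al * remainder g1 a z - be * remainder g1 a w)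
                       (al * remainder g2 b z - be * remainder g2 b w)) as [u [Hu Eu]].
  rewrite <- Eu. eapply Rle_trans;
    [ apply (combination_bound M g1 g2 g1' g2' u z w al be S M); auto; lra | fold a b ].
  assert (S0 : 0 <= S).
  { apply Rle_trans with (2 := HS 0%nat). apply Cmod_ge_0. }
  apply Rmult_le_compat_r; auto.
  apply Rplus_le_compat_l, Ropp_le_contravar.
  apply Rmult_le_compat_r; [ left; now apply Rinv_0_lt_compat | ].
  assert (T := Cmod_triangle (a + u * b) (- (u * b))).
  replace (a + u * b + - (u * b))%C with a in T by ring.
  rewrite Cmod_opp, Cmod_mult, Hu in T. apply pow_incr. lra.
Qed.

(** * Perturbing the map |z|^2 z *)

(** Adding a vector at an acute angle does not shorten. *)
Lemma Cmod_le_plus_acute (x y : C) :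
  0 <= Re (x * Cconj y) -> Cmod x <= Cmod (x + y).
Proof.
  intros H. apply Rsqr_incr_0; try apply Cmod_ge_0.
  rewrite !Rsqr_pow2, !Cmod2_alt. destruct x, y. unfold Re, Im in *; simpl in *. nra.
Qed.

Lemma Re_mul_conj_le (x y : C) : Re (x * Cconj y) <= Cmod x * Cmod y.
Proof. rewrite <- (Cmod_conj y), <- Cmod_mult. apply Re_le_Cmod. Qed.

Lemma Re_mul_conj_self (x : C) : Re (x * Cconj x) = Cmod x ^ 2.
Proof. now rewrite <- Cmod2_conj. Qed.

Definition radial_cube (z : C) : C := (RtoC (Cmod z ^ 2) * z)%C.

Lemma Cmod_radial_cube z : Cmod (radial_cube z) = Cmod z ^ 3.
Proof.
  unfold radial_cube. rewrite Cmod_mult, Cmod_R, Rabs_pos_eq by apply pow2_ge_0. ring.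
Qed.

(** With s = |z| >= t = |w|, the difference is t^2 (z - w) + (s^2 - t^2) z, and
    these two vectors form an acute angle. *)
Lemma radial_cube_expands z w :
  Cmod w <= Cmod z ->
  Cmod w ^ 2 * Cmod (z - w) <= Cmod (radial_cube z - radial_cube w).
Proof.
  intros H. assert (Hw := Cmod_ge_0 w).
  assert (E : (radial_cube z - radial_cube w =
     RtoC (Cmod w ^ 2) * (z - w) + RtoC (Cmod z ^ 2 - Cmod w ^ 2) * z)%C).
  { unfold radial_cube. rewrite RtoC_minus. ring. }
  rewrite E, <- (Rabs_pos_eq (Cmod w ^ 2)) at 1 by apply pow2_ge_0.
  rewrite <- Cmod_R, <- Cmod_mult. apply Cmod_le_plus_acute.
  replace (Re (RtoC (Cmod w ^ 2) * (z - w) * Cconj (RtoC (Cmod z ^ 2 - Cmod w ^ 2) * z)))%C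
    with (Cmod w ^ 2 * (Cmod z ^ 2 - Cmod w ^ 2) * (Re (z * Cconj z)%C - Re (w * Cconj z)%C)).
  - rewrite Re_mul_conj_self. assert (T := Re_mul_conj_le w z).
    apply Rmult_le_pos; [ apply Rmult_le_pos; [ apply pow2_ge_0 | nra ] | nra ].
  - generalize (Cmod w ^ 2) (Cmod z ^ 2 - Cmod w ^ 2). intros p q. destruct z, w. unfold Re; simpl. ring.
Qed.

Lemma radial_cube_injective z w : radial_cube z = radial_cube w -> z = w.
Proof.
  assert (G : forall z w, Cmod w <= Cmod z -> radial_cube z = radial_cube w -> z = w).
  { clear z w. intros z w H E.
    assert (Em : Cmod z ^ 3 = Cmod w ^ 3) by (rewrite <- !Cmod_radial_cube; now f_equal).
    assert (T := radial_cube_expands z w H). rewrite E in T.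
    replace (radial_cube w - radial_cube w)%C with (RtoC 0) in T by ring.
    rewrite Cmod_0 in T.
    destruct (Req_dec (Cmod w) 0) as [W|W].
    - rewrite W in Em. assert (Z : Cmod z = 0).
      { destruct (Req_dec (Cmod z) 0) as [|N]; auto. exfalso.
        assert (Cmod z ^ 3 <> 0) by now apply pow_nonzero. simpl in *. lra. }
      apply Cmod_eq_0 in W. apply Cmod_eq_0 in Z. congruence.
    - assert (P : 0 < Cmod w ^ 2) by (generalize (Cmod_ge_0 w); nra).
      assert (D : Cmod (z - w) = 0) by (generalize (Cmod_ge_0 (z - w)); nra).
      apply Cmod_eq_0 in D. replace z with ((z - w) + w)%C by ring. rewrite D. ring. }
  intros E. destruct (Rle_dec (Cmod w) (Cmod z)).
  - now apply G.
  - symmetry. apply G; [ lra | auto ].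
Qed.

(** Induction on the exponent, writing s^2 z^(n+2) - t^2 w^(n+2) as
    z (s^2 z^(n+1) - t^2 w^(n+1)) + w^(n+1) t^2 (z - w) with |w| = t <= s = |z|. *)
Lemma power_lipschitz z w r n :
  Cmod z <= r -> Cmod w <= r ->
  Cmod (RtoC (Cmod z ^ 2) * z ^ S n - RtoC (Cmod w ^ 2) * w ^ S n) <=
  INR (S n) * r ^ n * Cmod (radial_cube z - radial_cube w).
Proof.
  assert (G : forall z w, Cmod z <= r -> Cmod w <= Cmod z ->
    Cmod (RtoC (Cmod z ^ 2) * z ^ S n - RtoC (Cmod w ^ 2) * w ^ S n) <=
    INR (S n) * r ^ n * Cmod (radial_cube z - radial_cube w)).
  { clear z w. intros z w Hz Hw.
    assert (Hw0 := Cmod_ge_0 w). assert (Hz0 := Cmod_ge_0 z).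
    assert (D0 := Cmod_ge_0 (radial_cube z - radial_cube w)).
    assert (X := radial_cube_expands z w Hw).
    induction n as [|n IH].
    - rewrite !Cpow_1_r. unfold radial_cube. simpl. lra.
    - replace (RtoC (Cmod z ^ 2) * z ^ S (S n) - RtoC (Cmod w ^ 2) * w ^ S (S n))%C
        with (z * (RtoC (Cmod z ^ 2) * z ^ S n - RtoC (Cmod w ^ 2) * w ^ S n)
              + w ^ S n * (RtoC (Cmod w ^ 2) * (z - w)))%C by (rewrite !Cpow_S; ring).
      eapply Rle_trans; [ apply Cmod_triangle | ].
      rewrite (Cmod_mult z), (Cmod_mult (w ^ S n)), (Cmod_mult (RtoC _)), Cmod_pow, Cmod_R.
      rewrite (Rabs_pos_eq (Cmod w ^ 2)) by apply pow2_ge_0.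
      rewrite (S_INR (S n)).
      assert (B1 : Cmod z * Cmod (RtoC (Cmod z ^ 2) * z ^ S n - RtoC (Cmod w ^ 2) * w ^ S n)
                   <= r * (INR (S n) * r ^ n * Cmod (radial_cube z - radial_cube w))).
      { apply Rmult_le_compat; auto using Cmod_ge_0. }
      assert (B2 : Cmod w ^ S n * (Cmod w ^ 2 * Cmod (z - w))
                   <= r ^ S n * Cmod (radial_cube z - radial_cube w)).
      { apply Rmult_le_compat; auto.
        - now apply pow_le.
        - apply Rmult_le_pos; [ apply pow2_ge_0 | apply Cmod_ge_0 ].
        - apply pow_incr; lra. }
      simpl pow in *. lra. }
  intros Hz Hw. destruct (Rle_dec (Cmod w) (Cmod z)).
  - now apply G.
  - assert (S : forall x y : C, Cmod (x - y) = Cmod (y - x)).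
    { intros x y. rewrite <- Cmod_opp. f_equal. ring. }
    rewrite S, (S (radial_cube z)). apply G; lra.
Qed.

(** The formula is also right at v = 0: the factor v kills the arbitrary value of
    [Rpower 0]. *)
Definition radial_cbrt (v : C) : C := (RtoC (/ Rpower (Cmod v) (2 / 3)) * v)%C.

Lemma radial_cube_cbrt v : radial_cube (radial_cbrt v) = v.
Proof.
  unfold radial_cube, radial_cbrt.
  destruct (Ceq_dec v 0) as [->|Hv]; [ ring | ].
  apply Cmod_gt_0 in Hv. set (m := Cmod v) in *.
  set (q := Rpower m (2 / 3)).
  assert (Hq : 0 < q) by apply exp_pos.
  assert (E : q ^ 3 = m ^ 2).
  { unfold q. rewrite <- !Rpower_pow, Rpower_mult by (auto; apply exp_pos).
    f_equal. simpl. field. }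
  rewrite Cmod_mult, Cmod_R, Rabs_pos_eq by (left; now apply Rinv_0_lt_compat).
  fold m. rewrite Cmult_assoc, <- RtoC_mult.
  replace ((/ q * m) ^ 2 * / q) with (m ^ 2 / q ^ 3) by (field; lra).
  rewrite E. unfold Rdiv. rewrite Rinv_r by (apply pow_nonzero; lra). ring.
Qed.

(** Nearest-point projection onto the closed disk of radius s. *)
Definition clamp (s : R) (v : C) : C :=
  if Rle_dec (Cmod v) s then v else (RtoC (s / Cmod v) * v)%C.

Lemma Cmod_clamp s v : 0 < s -> Cmod (clamp s v) = Rmin (Cmod v) s.
Proof.
  intros Hs. unfold clamp. destruct (Rle_dec (Cmod v) s) as [H|H].
  - now rewrite Rmin_left.
  - apply Rnot_le_lt in H. rewrite Rmin_right by lra.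
    rewrite Cmod_mult, Cmod_R, Rabs_pos_eq.
    + field. lra.
    + left. apply Rdiv_lt_0_compat; lra.
Qed.

(** Variational characterization of the projection: v - P v makes an obtuse angle
    with x - P v for each x in the disk. *)
Lemma clamp_obtuse s v x :
  0 < s -> Cmod x <= s -> 0 <= Re ((clamp s v - x) * Cconj (v - clamp s v))%C.
Proof.
  intros Hs Hx.
  assert (Hm := Cmod_clamp s v Hs).
  assert (E : exists k, 0 <= k /\ (v - clamp s v = RtoC k * clamp s v)%C
                /\ (k = 0 \/ Cmod (clamp s v) = s)).
  { unfold clamp in *. destruct (Rle_dec (Cmod v) s) as [H|H].
    - exists 0. repeat split; auto; [ lra | ring ].
    - apply Rnot_le_lt in H. exists (Cmod v / s - 1). repeat split.
      + apply Rle_minus_r. rewrite Rplus_0_l. apply Rle_div_r; lra.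
      + rewrite Cmult_assoc, <- RtoC_mult.
        replace ((Cmod v / s - 1) * (s / Cmod v)) with (1 - s / Cmod v) by (field; lra).
        rewrite RtoC_minus. ring.
      + right. rewrite Hm, Rmin_right; lra. }
  destruct E as [k [Hk [E1 E2]]]. rewrite E1. set (p := clamp s v) in *.
  replace (Re ((p - x) * Cconj (RtoC k * p)))%C
    with (k * (Re (p * Cconj p)%C - Re (x * Cconj p)%C))
    by (destruct p, x; unfold Re; simpl; ring).
  destruct E2 as [->|E2]; [ lra | ].
  rewrite Re_mul_conj_self. assert (T := Re_mul_conj_le x p).
  rewrite E2 in *. apply Rmult_le_pos; auto. nra.
Qed.

Lemma clamp_nonexpansive s v w :
  0 < s -> Cmod (clamp s v - clamp s w) <= Cmod (v - w).
Proof.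
  intros Hs.
  assert (Hv : Cmod (clamp s v) <= s) by (rewrite Cmod_clamp; auto using Rmin_r).
  assert (Hw : Cmod (clamp s w) <= s) by (rewrite Cmod_clamp; auto using Rmin_r).
  assert (O1 := clamp_obtuse s v _ Hs Hw). assert (O2 := clamp_obtuse s w _ Hs Hv).
  set (p := clamp s v) in *. set (q := clamp s w) in *.
  replace (v - w)%C with ((p - q) + ((v - p) - (w - q)))%C by ring.
  apply Cmod_le_plus_acute.
  replace (Re ((p - q) * Cconj (v - p - (w - q))))%C
    with (Re ((p - q) * Cconj (v - p))%C + Re ((q - p) * Cconj (w - q))%C)
    by (destruct p, q, v, w; unfold Re; simpl; ring).
  lra.
Qed.

Lemma contraction_fixed_point (T : C -> C) k :
  0 <= k < 1 -> (forall x y, Cmod (T x - T y) <= k * Cmod (x - y)) ->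
  exists x, T x = x.
Proof.
  intros Hk HT.
  set (x := fun n => Nat.iter n T (RtoC 0)).
  set (d := fun n => (x (S n) - x n)%C).
  assert (Hd : forall n, Cmod (d n) <= Cmod (d 0%nat) * k ^ n).
  { induction n as [|n IH]; [ simpl; lra | ].
    eapply Rle_trans; [ apply (HT (x (S n)) (x n)) | ]. fold (d n). simpl.
    replace (Cmod (d 0%nat) * (k * k ^ n)) with (k * (Cmod (d 0%nat) * k ^ n)) by ring.
    apply Rmult_le_compat_l; lra. }
  assert (Hs : @ex_series C_AbsRing C_NormedModule d).
  { apply (@ex_series_le C_AbsRing C_CompleteNormedModule d (fun n => Cmod (d 0%nat) * k ^ n)).
    - exact Hd.
    - apply (ex_series_scal (Cmod (d 0%nat)) (fun n => k ^ n)), ex_series_geom.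
      rewrite Rabs_pos_eq; lra. }
  destruct Hs as [l Hl].
  assert (Hsum : forall n, sum_n (d : nat -> C_NormedModule) n = x (S n)).
  { induction n as [|n IH].
    - rewrite sum_O. change ((T (RtoC 0) - RtoC 0)%C = T (RtoC 0)). ring.
    - rewrite sum_Sn, IH.
      change ((x (S n) + (x (S (S n)) - x (S n)))%C = x (S (S n))). ring. }
  assert (Hlim : forall eps, 0 < eps -> exists N, forall n, (N <= n)%nat -> Cmod (x (S n) - l) < eps).
  { intros eps He.
    assert (L : @locally C_NormedModule l (fun v => Cmod (v - l) < eps)).
    { apply (@locally_le_locally_norm C_AbsRing C_NormedModule).
      exists (mkposreal eps He). intros y Hy. exact Hy. }
    destruct (Hl _ L) as [N HN]. exists N. intros n Hn. rewrite <- Hsum. now apply HN. }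
  exists l. apply Ceq_minus, Cmod_eq_0, Rle_antisym; [ | apply Cmod_ge_0 ].
  apply le_epsilon. intros eps He.
  destruct (Hlim (eps / 2)) as [N HN]; [ lra | ].
  assert (A1 := HN N (Nat.le_refl _)). assert (A2 := HN (S N) (Nat.le_succ_diag_r _)).
  assert (A3 := HT l (x (S N))).
  replace (T l - l)%C with ((T l - x (S (S N))) + (x (S (S N)) - l))%C by ring.
  eapply Rle_trans; [ apply Cmod_triangle | ].
  assert (A4 : Cmod (l - x (S N)) < eps / 2).
  { rewrite <- Cmod_opp. replace (- (l - x (S N)))%C with (x (S N) - l)%C by ring. auto. }
  change (x (S (S N))) with (T (x (S N))) in *.
  generalize (Cmod_ge_0 (l - x (S N))); nra.
Qed.

Definition real_linear (a b v : C) : C := (a * v + Cconj (b * v))%C.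

(** The next facts concern the real-linear map v |-> a v + conj(b v), whose smallest
    singular value is |a| - |b|. *)
Lemma real_linear_minus a b v w :
  (real_linear a b v - real_linear a b w)%C = real_linear a b (v - w).
Proof. unfold real_linear. rewrite !Cmult_conj, Cminus_conj. ring. Qed.

Lemma Cmod_real_linear_ge a b v :
  (Cmod a - Cmod b) * Cmod v <= Cmod (real_linear a b v).
Proof.
  unfold real_linear.
  assert (T := Cmod_triangle (a * v + Cconj (b * v)) (- Cconj (b * v))).
  replace (a * v + Cconj (b * v) + - Cconj (b * v))%C with (a * v)%C in T by ring.
  rewrite Cmod_opp, Cmod_conj, !Cmod_mult in T. lra.
Qed.

Definition real_linear_inv (a b w : C) : C :=
  ((Cconj a * w - Cconj (b * w)) / RtoC (Cmod a ^ 2 - Cmod b ^ 2))%C.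

Lemma real_linear_inv_r a b w :
  Cmod b < Cmod a -> real_linear a b (real_linear_inv a b w) = w.
Proof.
  intros H. unfold real_linear, real_linear_inv. set (D := Cmod a ^ 2 - Cmod b ^ 2).
  assert (HD : D <> 0) by (unfold D; generalize (Cmod_ge_0 b); nra).
  assert (HDC : RtoC D <> RtoC 0) by (intros E; now apply RtoC_inj in E).
  rewrite !Cmult_conj, Cdiv_conj, Cminus_conj, !Cmult_conj, !Cconj_conj by auto.
  replace (Cconj D) with (RtoC D) by (apply injective_projections; simpl; ring).
  transitivity ((a * Cconj a - b * Cconj b) * w / D)%C.
  - field. auto.
  - rewrite <- !Cmod2_conj, <- RtoC_minus. fold D. field. auto.
Qed.

Lemma perturbation_injective a b e r l L z w :
  0 < l <= Cmod a - Cmod b -> 0 <= L < l ->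
  (forall z w, Cmod z <= r -> Cmod w <= r ->
     Cmod (e z - e w) <= L * Cmod (radial_cube z - radial_cube w)) ->
  Cmod z <= r -> Cmod w <= r ->
  (real_linear a b (radial_cube z) + e z = real_linear a b (radial_cube w) + e w)%C ->
  z = w.
Proof.
  intros Hl HL He Hz Hw E. apply radial_cube_injective, Ceq_minus, Cmod_eq_0.
  specialize (He z w Hz Hw).
  assert (T := Cmod_real_linear_ge a b (radial_cube z - radial_cube w)).
  rewrite <- real_linear_minus in T.
  replace (real_linear a b (radial_cube z) - real_linear a b (radial_cube w))%C
    with (- (e z - e w))%C in T.
  - rewrite Cmod_opp in T. generalize (Cmod_ge_0 (radial_cube z - radial_cube w)). nra.
  - replace (real_linear a b (radial_cube z))
      with (real_linear a b (radial_cube z) + e z - e z)%C by ring.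
    rewrite E. ring.
Qed.

(** In the coordinate v = |z|^2 z the equation reads v = A^-1 (w - e(v)), where A is
    the real-linear part.  Composing e with the projection onto |v| <= r^3
    makes the right-hand side a contraction of the whole plane.  Its fixed
    point satisfies l |v| <= |w| + B, which excludes |v| >= r^3, so the
    projection does not act on it. *)
Lemma perturbation_covers a b e r l L B w :
  0 < l <= Cmod a - Cmod b -> 0 <= L < l ->
  (forall z w, Cmod z <= r -> Cmod w <= r ->
     Cmod (e z - e w) <= L * Cmod (radial_cube z - radial_cube w)) ->
  0 < r -> (forall z, Cmod z <= r -> Cmod (e z) <= B) ->
  Cmod w < l * r ^ 3 - B ->
  exists z, Cmod z < r /\ (real_linear a b (radial_cube z) + e z)%C = w.
Proof.
  intros Hl HL He Hr HB Hw.
  assert (Hr3 : 0 < r ^ 3) by now apply pow_lt.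
  set (root := fun v => radial_cbrt (clamp (r ^ 3) v)).
  assert (Hc : forall v, radial_cube (root v) = clamp (r ^ 3) v)
    by (intros; apply radial_cube_cbrt).
  assert (Hroot3 : forall v, Cmod (root v) ^ 3 = Rmin (Cmod v) (r ^ 3)).
  { intros v. now rewrite <- Cmod_radial_cube, Hc, Cmod_clamp. }
  assert (Hroot : forall v, Cmod (root v) <= r).
  { intros v. apply Rnot_lt_le. intros H.
    assert (r * r < Cmod (root v) * Cmod (root v)) by nra.
    assert (Hlt : r ^ 3 < Cmod (root v) ^ 3) by (simpl; nra).
    rewrite Hroot3 in Hlt. generalize (Rmin_r (Cmod v) (r ^ 3)). lra. }
  assert (Hab : Cmod b < Cmod a) by lra.
  set (T := fun v => real_linear_inv a b (w - e (root v))).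
  assert (HT : forall v, real_linear a b (T v) = (w - e (root v))%C)
    by (intros; now apply real_linear_inv_r).
  destruct (contraction_fixed_point T (L / l)) as [v Hv].
  - split.
    + apply Rle_mult_inv_pos; lra.
    + apply Rlt_div_l; lra.
  - intros x y.
    assert (A1 := Cmod_real_linear_ge a b (T x - T y)).
    rewrite <- real_linear_minus, !HT in A1.
    replace (w - e (root x) - (w - e (root y)))%C with (e (root y) - e (root x))%C in A1 by ring.
    assert (A2 := He (root y) (root x) (Hroot y) (Hroot x)). rewrite !Hc in A2.
    assert (A3 := clamp_nonexpansive (r ^ 3) y x Hr3).
    replace (x - y)%C with (- (y - x))%C by ring. rewrite Cmod_opp.
    replace (L / l * Cmod (y - x)) with ((L * Cmod (y - x)) / l) by (field; lra).
    apply Rle_div_r; [ lra | ].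
    assert (P := Cmod_ge_0 (T x - T y)).
    assert (L * Cmod (clamp (r ^ 3) y - clamp (r ^ 3) x) <= L * Cmod (y - x))
      by (apply Rmult_le_compat_l; lra).
    nra.
  - assert (E : (real_linear a b v + e (root v))%C = w).
    { rewrite <- Hv at 1. rewrite HT. ring. }
    assert (Small : Cmod v < r ^ 3).
    { apply Rnot_le_lt. intros H.
      assert (A1 := Cmod_real_linear_ge a b v).
      replace (real_linear a b v) with (w + - e (root v))%C in A1 by (rewrite <- E; ring).
      assert (A2 := Cmod_triangle w (- e (root v))). rewrite Cmod_opp in A2.
      specialize (HB (root v) (Hroot v)).
      assert (l * r ^ 3 <= (Cmod a - Cmod b) * Cmod v) by (apply Rmult_le_compat; lra).
      lra. }
    exists (root v). split.
    + apply Rnot_le_lt. intros H.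
      assert (r ^ 3 <= Cmod (root v) ^ 3) by (apply pow_incr; lra).
      rewrite Hroot3, Rmin_left in H0 by lra. lra.
    + rewrite Hc. unfold clamp. destruct (Rle_dec (Cmod v) (r ^ 3)); [ exact E | lra ].
Qed.

(** * The constants lambda0, r4' and their inequalities *)

(** Raised to the fourth power this is (pi^2 - 16)^2 >= 0. *)
Lemma M0_ge_1 : 1 <= M0.
Proof.
  unfold M0. assert (P := PI2_3_2).
  assert (Hs : 0 < 2 * PI ^ 2 - 16) by (simpl; nra).
  assert (Hq : 0 < sqrt (sqrt (2 * PI ^ 2 - 16))) by now apply sqrt_lt_R0, sqrt_lt_R0.
  apply Rle_div_r; [ lra | ]. rewrite Rmult_1_l.
  apply Rsqr_incr_0; try lra. rewrite Rsqr_mult, Rsqr_sqrt by apply sqrt_pos.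
  apply Rsqr_incr_0; try (unfold Rsqr; nra).
  - rewrite Rsqr_mult, Rsqr_sqrt by lra. unfold Rsqr.
    generalize (pow2_ge_0 (PI ^ 2 - 16)). simpl. nra.
  - generalize (sqrt_pos (2 * PI ^ 2 - 16)). unfold Rsqr; lra.
Qed.

(** For M <= M0, the square of sqrt (M^2 - 1) + sqrt (M^2 + 1) is at least 2 M^2;
    for M > M0, pi/4 <= 1. *)
Lemma lambda0_bounds M : 1 <= M -> 0 < lambda0 M <= / M.
Proof.
  intros HM. unfold lambda0. destruct (Rle_dec M M0) as [H|H].
  - set (x := sqrt (M ^ 2 - 1)). set (y := sqrt (M ^ 2 + 1)).
    assert (Hx : 0 <= x) by apply sqrt_pos.
    assert (Hy : 0 < y) by (apply sqrt_lt_R0; nra).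
    assert (Ex : x * x = M ^ 2 - 1) by (apply sqrt_sqrt; nra).
    assert (Ey : y * y = M ^ 2 + 1) by (apply sqrt_sqrt; nra).
    assert (H2 : 0 < sqrt 2) by (apply sqrt_lt_R0; lra).
    assert (E2 : sqrt 2 * sqrt 2 = 2) by (apply sqrt_sqrt; lra).
    split; [ apply Rdiv_lt_0_compat; lra | ].
    apply Rle_div_l; [ lra | ].
    replace (/ M * (x + y)) with ((x + y) / M) by (field; lra).
    apply Rle_div_r; [ lra | ].
    apply Rsqr_incr_0; try nra. unfold Rsqr. nra.
  - assert (P := PI_4). assert (P0 := PI_RGT_0). split.
    + apply Rdiv_lt_0_compat; lra.
    + apply Rle_div_l; [ lra | ]. replace (/ M * (4 * M)) with 4 by (field; lra). auto.
Qed.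

Lemma lambda0_1 : lambda0 1 = 1.
Proof.
  unfold lambda0. destruct (Rle_dec 1 M0) as [H|H]; [ | generalize M0_ge_1; lra ].
  replace (1 ^ 2 - 1) with 0 by ring. replace (1 ^ 2 + 1) with 2 by ring.
  rewrite sqrt_0, Rplus_0_l. field.
  apply Rgt_not_eq, sqrt_lt_R0. lra.
Qed.

(** The bound K on the coefficients of index at least 2. *)
Definition coef_max (M : R) : R := M - lambda0 M ^ 2 / M.

Lemma coef_max_1 : coef_max 1 = 0.
Proof. unfold coef_max. rewrite lambda0_1. field. Qed.

Lemma coef_max_pos M : 1 < M -> 0 < coef_max M.
Proof.
  intros HM. unfold coef_max. destruct (lambda0_bounds M) as [H1 H2]; [ lra | ].
  assert (/ M < 1) by (rewrite <- Rinv_1; apply Rinv_lt_contravar; lra).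
  assert (lambda0 M ^ 2 / M < M); [ | lra ].
  apply Rlt_div_l; nra.
Qed.

Lemma coef_max_ge0 M : 1 <= M -> 0 <= coef_max M.
Proof.
  intros [H|<-]; [ left; now apply coef_max_pos | rewrite coef_max_1; lra ].
Qed.

Lemma r4'_eq M : r4' M = lambda0 M / (lambda0 M + 2 * coef_max M
   + sqrt (lambda0 M * coef_max M + 4 * coef_max M ^ 2)).
Proof. reflexivity. Qed.

Lemma r4'_1 : r4' 1 = 1.
Proof.
  rewrite r4'_eq, coef_max_1, lambda0_1.
  replace (1 * 0 + 4 * 0 ^ 2) with 0 by ring. rewrite sqrt_0. field.
Qed.

Lemma r4'_pos M : 1 <= M -> 0 < r4' M.
Proof.
  intros HM. rewrite r4'_eq. destruct (lambda0_bounds M HM) as [H _].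
  assert (HK := coef_max_ge0 M HM).
  generalize (sqrt_pos (lambda0 M * coef_max M + 4 * coef_max M ^ 2)). intros.
  apply Rdiv_lt_0_compat; lra.
Qed.

Lemma r4'_lt_1 M : 1 < M -> r4' M < 1.
Proof.
  intros HM. rewrite r4'_eq. destruct (lambda0_bounds M) as [H _]; [ lra | ].
  assert (HK := coef_max_pos M HM).
  generalize (sqrt_pos (lambda0 M * coef_max M + 4 * coef_max M ^ 2)). intros.
  apply Rlt_div_l; lra.
Qed.

Lemma r4'_le_1 M : 1 <= M -> r4' M <= 1.
Proof.
  intros [H|<-]; [ left; now apply r4'_lt_1 | rewrite r4'_1; lra ].
Qed.

Lemma slope_lt M r :
  1 <= M -> 0 <= r <= r4' M -> r < 1 ->
  coef_max M * (/ (1 - r) ^ 2 - 1) < lambda0 M.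
Proof.
  intros HM Hr Hr1. destruct (lambda0_bounds M HM) as [Hl _].
  assert (HK := coef_max_ge0 M HM). rewrite r4'_eq in Hr.
  set (l := lambda0 M) in *. set (K := coef_max M) in *.
  set (D := sqrt (l * K + 4 * K ^ 2)) in *.
  assert (HD : 0 <= D) by apply sqrt_pos.
  assert (HDD : D * D = l * K + 4 * K ^ 2) by (apply sqrt_sqrt; nra).
  assert (Hr2 : r * (l + 2 * K + D) <= l) by (apply Rle_div_r; lra).
  assert (Hq : 0 <= l * (1 - r) ^ 2 - K * (4 * r - 3 * r ^ 2)).
  { assert (Hp : 0 <= (l - (l + 2 * K + D) * r) * (l - (l + 2 * K - D) * r)).
    { apply Rmult_le_pos; nra. }
    (* This product is l times l (1-r)^2 - K (4r - 3r^2), factored by its roots in r. *)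
    replace ((l - (l + 2 * K + D) * r) * (l - (l + 2 * K - D) * r))
      with (l * (l - (2 * l + 4 * K) * r) + ((l + 2 * K) ^ 2 - D * D) * r ^ 2) in Hp by ring.
    rewrite HDD in Hp.
    replace (l * (l - (2 * l + 4 * K) * r) + ((l + 2 * K) ^ 2 - (l * K + 4 * K ^ 2)) * r ^ 2)
      with (l * (l * (1 - r) ^ 2 - K * (4 * r - 3 * r ^ 2))) in Hp by ring.
    apply Rmult_le_reg_l with l; [ auto | lra ]. }
  assert (P : 0 < (1 - r) ^ 2) by (apply pow_lt; lra).
  apply Rmult_lt_reg_r with ((1 - r) ^ 2); auto.
  replace (K * (/ (1 - r) ^ 2 - 1) * (1 - r) ^ 2) with (K * (2 * r - r ^ 2)) by (field; lra).
  destruct (Req_dec (K * r) 0) as [Z|Z].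
  - replace (K * (2 * r - r ^ 2)) with ((K * r) * (2 - r)) by ring. rewrite Z. nra.
  - assert (0 < K * r) by (assert (0 <= K * r) by nra; lra).
    assert (0 < (K * r) * (2 - 2 * r)) by (apply Rmult_lt_0_compat; lra). nra.
Qed.

(** * Univalence and covering *)

(** The perturbation e in F = (real-linear part of |z|^2 z) + e. *)
Definition cubic_error (g1 g2 : C -> C) (a b z : C) : C :=
  (RtoC (Cmod z ^ 2) * (remainder g1 a z + Cconj (remainder g2 b z)))%C.

Lemma cubic_error_lipschitz M l g1 g2 g1' g2' r z w :
  bounded_pair M g1 g2 g1' g2' ->
  0 < M -> 0 <= l <= Cmod (g1' (RtoC 0)) - Cmod (g2' (RtoC 0)) ->
  Cmod z <= r -> Cmod w <= r -> r < 1 ->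
  Cmod (cubic_error g1 g2 (g1' 0) (g2' 0) z - cubic_error g1 g2 (g1' 0) (g2' 0) w) <=
  (M - l ^ 2 / M) * (/ (1 - r) ^ 2 - 1) * Cmod (radial_cube z - radial_cube w).
Proof.
  intros HP M_pos Hl Hz Hw Hr.
  assert (Hr0 : 0 <= r) by (eapply Rle_trans, Hz; apply Cmod_ge_0).
  assert (B := pair_bound M g1 g2 g1' g2' l z w (RtoC (Cmod z ^ 2)) (RtoC (Cmod w ^ 2))
    ((/ (1 - r) ^ 2 - 1) * Cmod (radial_cube z - radial_cube w)) HP M_pos Hl).
  rewrite Rmult_assoc. eapply Rle_trans; [ | apply B; try lra ].
  - set (X := (RtoC (Cmod z ^ 2) * remainder g1 (g1' 0) z - RtoC (Cmod w ^ 2) * remainder g1 (g1' 0) w)%C).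
    set (Y := (RtoC (Cmod z ^ 2) * remainder g2 (g2' 0) z - RtoC (Cmod w ^ 2) * remainder g2 (g2' 0) w)%C).
    replace (cubic_error g1 g2 (g1' 0) (g2' 0) z - cubic_error g1 g2 (g1' 0) (g2' 0) w)%C
      with (X + Cconj Y)%C.
    + rewrite <- (Cmod_conj Y). apply Cmod_triangle.
    + unfold X, Y, cubic_error. rewrite Cminus_conj, !Cmult_conj.
      assert (Q : forall x : R, Cconj x = RtoC x)
        by (intros; apply injective_projections; simpl; ring).
      rewrite !Q. ring.
  - intros N. eapply Rle_trans.
    + apply sum_Rle with (Bn := fun k => INR (k + 2) * r ^ (k + 1) * Cmod (radial_cube z - radial_cube w)).
      intros k _. replace (k + 2)%nat with (S (k + 1)) by lia. now apply power_lipschitz.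
    + rewrite <- scal_sum, Rmult_comm. apply Rmult_le_compat_r; [ apply Cmod_ge_0 | ].
      now apply derived_geometric_sum_le.
Qed.

Lemma cubic_error_bound M l g1 g2 g1' g2' r z :
  bounded_pair M g1 g2 g1' g2' ->
  0 < M -> 0 <= l <= Cmod (g1' (RtoC 0)) - Cmod (g2' (RtoC 0)) -> 0 <= M - l ^ 2 / M ->
  Cmod z <= r -> r < 1 ->
  Cmod (cubic_error g1 g2 (g1' 0) (g2' 0) z) <= (M - l ^ 2 / M) * (r ^ 4 / (1 - r)).
Proof.
  intros HP M_pos Hl HK Hz Hr.
  assert (Hz0 := Cmod_ge_0 z).
  assert (B := pair_bound M g1 g2 g1' g2' l z 0 (RtoC 1) (RtoC 0)
    (r ^ 2 / (1 - r)) HP M_pos Hl).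
  unfold cubic_error. rewrite Cmod_mult, Cmod_R, Rabs_pos_eq by apply pow2_ge_0.
  replace ((M - l ^ 2 / M) * (r ^ 4 / (1 - r)))
    with (r ^ 2 * ((M - l ^ 2 / M) * (r ^ 2 / (1 - r)))) by (field; lra).
  apply Rmult_le_compat; [ apply pow2_ge_0 | apply Cmod_ge_0 | apply pow_incr; lra | ].
  eapply Rle_trans; [ | apply B; try lra ].
  - eapply Rle_trans; [ apply Cmod_triangle | ]. rewrite Cmod_conj.
    right. f_equal; f_equal; ring.
  - rewrite Cmod_0. lra.
  - intros N. eapply Rle_trans; [ | apply (geometric_sum_le r N); lra ].
    apply sum_Rle. intros k _.
    replace (1 * z ^ (k + 2) - 0 * 0 ^ (k + 2))%C with (z ^ (k + 2))%C by ring.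
    rewrite Cmod_pow. apply pow_incr. lra.
Qed.

Lemma sq_mod_mul_decomposition g g1 g2 a b z :
  g z = (g1 z + Cconj (g2 z))%C ->
  sq_mod_mul g z = (real_linear a b (radial_cube z) + cubic_error g1 g2 a b z)%C.
Proof.
  intros E. unfold sq_mod_mul, real_linear, radial_cube, cubic_error, remainder. rewrite E.
  rewrite !Cminus_conj, !Cmult_conj.
  assert (Q : forall x : R, Cconj x = RtoC x)
    by (intros; apply injective_projections; simpl; ring).
  rewrite Q. ring.
Qed.

(** From (A + B) (A - B) = 1. *)
Lemma lower_derivative_bound M A B :
  0 <= B -> 0 <= A -> A ^ 2 - B ^ 2 = 1 -> A + B <= M -> 1 <= M /\ / M <= A - B.
Proof.
  intros HB HA H1 H2.
  assert (H3 : (A + B) * (A - B) = 1) by (rewrite <- H1; ring).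
  assert (1 <= A) by nra.
  split; [ lra | ].
  apply Rmult_le_reg_l with M; [ lra | ]. rewrite Rinv_r by lra. nra.
Qed.

Lemma univalent_and_covering M g g1 g2 :
  admissible M g g1 g2 ->
  univalent_on (disk 1) (sq_mod_mul g) (disk (r4' M)) /\
  image_contains (sq_mod_mul g) (disk (r4' M)) (disk (sigma4' M)).
Proof.
  intros (Hh & Ha1 & Ha2 & Hg & E2 & Eg & Hj & HM).
  destruct (harmonic_parts_holo g g1 g2 Hh Ha1 Ha2 Hg) as [H1 H2].
  assert (D0 : disk 1 (RtoC 0)) by (unfold disk; rewrite Cmod_0; lra).
  assert (E1 : g1 (RtoC 0) = RtoC 0).
  { rewrite Hg, E2 in Eg by auto. rewrite <- Eg at 2.
    apply injective_projections; simpl; ring. }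
  set (g1' := d_z g) in *. set (g2' := fun z => Cconj (d_zbar g z)) in *.
  assert (HP : bounded_pair M g1 g2 g1' g2') by exact (conj H1 (conj H2 (conj E1 (conj E2 HM)))).
  assert (Hd := sum_derivatives_le M g1 g2 g1' g2' HP).
  assert (J : Cmod (g1' (RtoC 0)) ^ 2 - Cmod (g2' (RtoC 0)) ^ 2 = 1).
  { unfold g2'. rewrite Cmod_conj. unfold jacobian in Hj. unfold g1'. lra. }
  destruct (lower_derivative_bound M _ _ (Cmod_ge_0 _) (Cmod_ge_0 _) J Hd) as [HM1 Hlow].
  destruct (lambda0_bounds M HM1) as [Hl0 Hl1].
  assert (Hl : 0 < lambda0 M <= Cmod (g1' (RtoC 0)) - Cmod (g2' (RtoC 0))) by lra.
  assert (HK := coef_max_ge0 M HM1).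
  assert (M_pos : 0 < M) by lra.
  assert (Hl' : 0 <= lambda0 M <= Cmod (g1' (RtoC 0)) - Cmod (g2' (RtoC 0))) by lra.
  assert (R1 := r4'_le_1 M HM1). assert (R0 := r4'_pos M HM1).
  set (e := cubic_error g1 g2 (g1' 0) (g2' 0)).
  assert (Dec : forall z, disk 1 z ->
    sq_mod_mul g z = (real_linear (g1' 0) (g2' 0) (radial_cube z) + e z)%C).
  { intros z Hz. apply sq_mod_mul_decomposition. now apply Hg. }
  assert (Lip : forall r z w, r < 1 -> Cmod z <= r -> Cmod w <= r -> Cmod (e z - e w) <=
    coef_max M * (/ (1 - r) ^ 2 - 1) * Cmod (radial_cube z - radial_cube w)).
  { intros r z w Hr Hz Hw. now apply cubic_error_lipschitz. }
  assert (Slope : forall r, 0 <= r <= r4' M -> r < 1 ->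
    0 <= coef_max M * (/ (1 - r) ^ 2 - 1) < lambda0 M).
  { intros r Hr Hr1. split; [ | now apply slope_lt ].
    apply Rmult_le_pos; auto. apply Rle_minus_r. rewrite Rplus_0_l, <- Rinv_1.
    apply Rinv_le_contravar; [ apply pow_lt; lra | ]. rewrite <- (pow1 2). apply pow_incr. lra. }
  assert (Cover : forall r v, 0 < r <= r4' M -> r < 1 ->
    Cmod v < lambda0 M * r ^ 3 - coef_max M * (r ^ 4 / (1 - r)) ->
    exists z, disk (r4' M) z /\ sq_mod_mul g z = v).
  { intros r v Hr Hr1 Hv.
    destruct (perturbation_covers (g1' 0) (g2' 0) e r (lambda0 M) _
      (coef_max M * (r ^ 4 / (1 - r))) v Hl (Slope r ltac:(lra) Hr1)
      (fun z w => Lip r z w Hr1)) as [z [Hz Ez]]; try lra.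
    - intros z Hz. now apply cubic_error_bound.
    - exists z. unfold disk. split; [ lra | ]. rewrite Dec; auto. unfold disk; lra. }
  split.
  - split.
    + unfold disk. intros z Hz. lra.
    + unfold disk. intros z w Hz Hw E.
      set (r := Rmax (Cmod z) (Cmod w)).
      assert (Hr : r < r4' M) by now apply Rmax_lub_lt.
      assert (Hr0 : 0 <= r) by (eapply Rle_trans, Rmax_l; apply Cmod_ge_0).
      rewrite !Dec in E by (unfold disk; lra).
      apply (perturbation_injective (g1' 0) (g2' 0) e r (lambda0 M) _ z w Hl (Slope r ltac:(lra) ltac:(lra))
        (fun z w => Lip r z w ltac:(lra))); auto.
      * apply Rmax_l.
      * apply Rmax_r.
  - intros v Hv. unfold disk, sigma4' in Hv.
    destruct (Rlt_dec 1 M) as [Hgt|Hle].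
    + apply (Cover (r4' M)); auto; [ lra | now apply r4'_lt_1 ].
    + (* For M = 1 the radius is 1 and the error bound vanishes, so any r < 1 with
         |v| < r^3 serves; r = 1 - (1 - |v|)/3 works by Bernoulli's inequality. *)
      assert (M = 1) by lra. subst M.
      assert (Hv0 := Cmod_ge_0 v).
      set (x := (1 - Cmod v) / 3).
      apply (Cover (1 - x)).
      * rewrite r4'_1. unfold x. lra.
      * unfold x; lra.
      * rewrite coef_max_1, lambda0_1. unfold x.
        assert (0 < (1 - Cmod v) ^ 2 * (8 + Cmod v)) by (apply Rmult_lt_0_compat; [ apply pow_lt|]; lra).
        nra.
Qed.

(** * Sharpness *)

Lemma is_derive_affine (f : R -> R) p c t : (forall s, f s = p * s + c) -> is_derive f t p.
Proof.
  intros H. apply (is_derive_ext (fun s => p * s + c)).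
  - intros s. now rewrite H.
  - auto_derive; [ exact I | ring ].
Qed.

(** Stated for functions equal to an affine one, so that the partial derivatives,
    themselves constant, fall under the induction hypothesis. *)
Lemma ex_diff_n_affine n (f : R -> R -> R) p q c x y :
  (forall x y, f x y = p * x + q * y + c) -> ex_diff_n f n x y.
Proof.
  revert f p q c. induction n as [|n IH]; intros f p q c H;
    assert (Hc : continuity_2d_pt f x y).
  1, 3: apply (continuity_2d_pt_ext (fun x y => p * x + q * y + c));
    [ intros; now rewrite H | ];
    repeat first [ apply continuity_2d_pt_plus | apply continuity_2d_pt_mult
                 | apply continuity_2d_pt_const | apply continuity_2d_pt_id1
                 | apply continuity_2d_pt_id2 ].
  - split; auto.
  - assert (Dx : forall u v, is_derive (fun z => f z v) u p).
    { intros u v. apply is_derive_affine with (q * v + c). intros; rewrite H; ring. }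
    assert (Dy : forall u v, is_derive (fun z => f u z) v q).
    { intros u v. apply is_derive_affine with (p * u + c). intros; rewrite H; ring. }
    split; [ auto | split; [ | split; [ | split ]]].
    + exists p. apply Dx.
    + exists q. apply Dy.
    + apply (IH _ 0 0 p). intros u v. etransitivity; [ apply is_derive_unique, Dx | ring ].
    + apply (IH _ 0 0 q). intros u v. etransitivity; [ apply is_derive_unique, Dy | ring ].
Qed.

Lemma real_harmonic_affine D (f : R -> R -> R) p q c :
  (forall x y, f x y = p * x + q * y + c) -> real_harmonic_on D f.
Proof.
  intros H x y _. split; [ now apply ex_diff_n_affine with p q c | ].
  unfold partial_derive; simpl.
  rewrite (Derive_ext (fun x => Derive (fun t => f t y) x) (fun _ => p)).
  - rewrite (Derive_ext (fun z => Derive (fun z => f x z) z) (fun _ => q)).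
    + rewrite !Derive_const. ring.
    + intros t. apply is_derive_unique, is_derive_affine with (p * x + c). intros; rewrite H; ring.
  - intros t. apply is_derive_unique, is_derive_affine with (q * y + c). intros; rewrite H; ring.
Qed.

Lemma identity_admissible :
  admissible 1 (fun z => z) (fun z => z) (fun _ => RtoC 0).
Proof.
  assert (C0 : Cconj (RtoC 0) = RtoC 0) by (apply injective_projections; simpl; ring).
  assert (Hg : forall z : C, z = (z + Cconj 0)%C) by (intros; rewrite C0; ring).
  refine (conj (conj _ _) (conj _ (conj _ (conj _ (conj eq_refl (conj eq_refl (conj _ _))))))).
  - apply real_harmonic_affine with 1 0 0. intros; simpl; ring.
  - apply real_harmonic_affine with 0 1 0. intros; simpl; ring.
  - intros z _. exists (RtoC 1). apply Cdiff_is_derive, Cdiff_id.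
  - intros z _. exists (RtoC 0). apply Cdiff_is_derive, Cdiff_const.
  - intros z _. apply Hg.
  - assert (D0 : disk 1 (RtoC 0)) by (unfold disk; rewrite Cmod_0; lra).
    unfold jacobian.
    rewrite (d_z_analytic (fun z => z) (fun z => z) (fun _ => 0%C) (fun z _ => Hg z) 0 _ _ D0 (Cdiff_id _) (Cdiff_const _ _)).
    rewrite (d_zbar_analytic (fun z => z) (fun z => z) (fun _ => 0%C) (fun z _ => Hg z) 0 _ _ D0 (Cdiff_id _) (Cdiff_const _ _)).
    rewrite Cmod_conj, Cmod_1, Cmod_0. ring.
  - unfold disk. intros z Hz. rewrite Cmod_0. lra.
Qed.

Lemma sigma4'_1 : sigma4' 1 = 1.
Proof. unfold sigma4'. destruct (Rlt_dec 1 1); lra. Qed.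

Theorem corollary2 :
  (forall (M : R) (g g1 g2 : C -> C),
     admissible M g g1 g2 ->
     univalent_on (disk 1) (sq_mod_mul g) (disk (r4' M)) /\
     image_contains (sq_mod_mul g) (disk (r4' M)) (disk (sigma4' M)))
  /\
  (r4' 1 = 1 /\
   sigma4' 1 = 1 /\
   (forall rho : R,
      (forall g g1 g2 : C -> C,
         admissible 1 g g1 g2 ->
         univalent_on (disk 1) (sq_mod_mul g) (disk rho)) ->
      rho <= r4' 1) /\
   (forall sigma : R,
      (forall g g1 g2 : C -> C,
         admissible 1 g g1 g2 ->
         image_contains (sq_mod_mul g) (disk (r4' 1)) (disk sigma)) ->
      sigma <= sigma4' 1)).
Proof.
  split; [ exact univalent_and_covering | ].
  split; [ exact r4'_1 | ]. split; [ exact sigma4'_1 | ].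
  rewrite r4'_1, sigma4'_1. split.
  - intros rho H. destruct (H _ _ _ identity_admissible) as [H1 _].
    apply Rnot_lt_le. intros Hr. specialize (H1 (RtoC 1)). unfold disk in H1.
    rewrite Cmod_1 in H1. specialize (H1 Hr). lra.
  - intros sigma H. apply Rnot_lt_le. intros Hs.
    destruct (H _ _ _ identity_admissible (RtoC 1)) as [z [Hz E]].
    + unfold disk. now rewrite Cmod_1.
    + unfold disk in Hz. apply (f_equal Cmod) in E.
      change (sq_mod_mul (fun z => z) z) with (radial_cube z) in E.
      rewrite Cmod_radial_cube, Cmod_1 in E. generalize (Cmod_ge_0 z); intros.
      assert (Cmod z * Cmod z < 1) by nra. simpl in E. nra.
Qed.
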